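(* Let $\lambda\in(0,\infty)$ and let $\phi$ be a probability density function on $\mathbb R_+=[0,\infty)$; thus $\nu(dx)=\lambda\phi(x)\,dx$ is the Lévy measure of a compound Poisson distribution $\mu$ on $\mathbb R_+$. For $t>0$ let $$p^t(x):=(e^{\lambda t}-1)^{-1}\sum_{n=1}^{\infty}\frac{(\lambda t)^n}{n!}\phi^{n\otimes}(x),\qquad p(x):=p^1(x),$$ so that $\mu^{t*}(dx)=e^{-\lambda t}\delta_0(dx)+(1-e^{-\lambda t})p^t(x)\,dx$. Assume that $\int_0^\infty(\phi(x))^2dx<\infty$. Then: (i) If $p^t\in\mathcal S_d$ for some $t>0$, then for all $t>0$ we have $p^t\in\mathcal S_d$ and $$(1-e^{-\lambda t})p^t(x)\sim t(1-e^{-\lambda})p(x).$$ (ii) If $p\in\mathcal L_d$ and, for some $t\in(0,1)\cup(1,\infty)$, there is $C(t)\in(0,\infty)$ such that $$(1-e^{-\lambda t})p^t(x)\sim C(t)(1-e^{-\lambda})p(x),$$ then $C(t)=t$ and $p\in\mathcal S_d$.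
   Context: A probability density function is a nonnegative measurable function with integral $1$; a density on $\mathbb R_+$ is regarded as a density on $\mathbb R$ vanishing on $(-\infty,0)$. Densities are treated as pointwise defined functions. $f\otimes g(x)=\int f(x-u)g(u)\,du$ is the convolution (a nonnegative, possibly infinite, Lebesgue integral), and $f^{n\otimes}$ is the $n$-th convolution power ($f^{1\otimes}=f$). For functions $f_1,g_1$ that are positive on some $[A,\infty)$, $f_1(x)\sim g_1(x)$ means $\lim_{x\to\infty}f_1(x)/g_1(x)=1$. A nonnegative measurable function $g$ on $\mathbb R$ is in the class $\mathbf L$ (long-tailed) if $g(x+a)\sim g(x)$ for every $a\in\mathbb R$ (in particular $g$ is eventually positive). A probability density $g$ on $\mathbb R$ is in $\mathcal L_d$ if $g\in\mathbf L$. A probability density $g$ on $\mathbb R$ is in $\mathcal S_d$ (subexponential density) if $g\in\mathcal L_d$ and $g^{2\otimes}(x)\sim 2g(x)$. $\delta_0$ denotes the delta measure at $0$, and $\mu^{t*}$ is the $t$-th convolution power of $\mu$, i.e. the compound Poisson distribution with Lévy measure $t\nu$. *)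

(* Defs.v *)
From HB Require Import structures.
From mathcomp Require Import all_boot all_order all_algebra.
From mathcomp Require Import all_classical all_reals all_analysis.
(* for the Borel structure of \bar R, not exported by all_analysis *)
From mathcomp Require Import measurable_realfun.

Set Implicit Arguments.
Unset Strict Implicit.
Unset Printing Implicit Defensive.

Import Order.TTheory GRing.Theory Num.Theory.
Import numFieldNormedType.Exports.

Local Open Scope classical_set_scope.
Local Open Scope ring_scope.
Local Open Scope ereal_scope.

(* All functions take values in \bar R, because a convolution (and hence a
   convolution power or a series of them) may be infinite at some points.
   A density is nevertheless required to be finite at every point. *)

(* Borel measurable, with values in [0, +oo[. *)
Definition nonneg_measurable (R : realType) (g : R -> \bar R) : Prop :=
  (forall x, 0 <= g x < +oo) /\ measurable_fun [set: R] g.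

Definition is_density (R : realType) (g : R -> \bar R) : Prop :=
  nonneg_measurable g /\ \int[@lebesgue_measure R]_x g x = 1.

Definition convolution (R : realType) (f g : R -> \bar R) : R -> \bar R :=
  fun x => \int[@lebesgue_measure R]_u (f (x - u)%R * g u).

(* The n-th convolution power for n >= 1; the value at n = 0 (where the
   convolution power is the Dirac mass, not a function) is junk. *)
Definition conv_pow (R : realType) (f : R -> \bar R) (n : nat) : R -> \bar R :=
  iter n.-1 (convolution f) f.

(* For positive numerator and denominator, a quotient in \bar R with an
   infinite term is 0 or +oo (x / +oo = 0 for every x, +oo included), so a
   limit equal to 1 forces both functions to be finite near +oo. *)
Definition asymp_equiv (R : realType) (f g : R -> \bar R) : Prop :=
  (\forall x \near +oo%R, 0 < f x /\ 0 < g x) /\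
  f x / g x @[x --> +oo%R] --> 1.

Definition long_tailed (R : realType) (g : R -> \bar R) : Prop :=
  nonneg_measurable g /\
  forall a : R, asymp_equiv (fun x => g (x + a)%R) g.

Definition long_tailed_density (R : realType) (g : R -> \bar R) : Prop :=
  is_density g /\ long_tailed g.

Definition subexp_density (R : realType) (g : R -> \bar R) : Prop :=
  long_tailed_density g /\ asymp_equiv (conv_pow g 2) (fun x => 2%:E * g x).

(* For t > 0, the density of the absolutely continuous part, normalized to
   mass 1, of the t-th convolution power of the compound Poisson distribution
   with Levy measure lam * phi(x) dx. *)
Definition cpoisson_density (R : realType) (lam : R) (phi : R -> \bar R)
    (t : R) : R -> \bar R :=
  fun x => ((expR (lam * t) - 1)^-1)%:E *
    \sum_(1 <= n <oo) (((lam * t) ^+ n / n`!%:R)%:E * conv_pow phi n x).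

(* Main.v *)
Require Import Defs.
From HB Require Import structures.
From mathcomp Require Import all_boot all_order all_algebra.
From mathcomp Require Import all_classical all_reals all_analysis.
From mathcomp Require Import measurable_realfun.
From mathcomp Require Import ring lra.

Set Implicit Arguments.
Unset Strict Implicit.
Unset Printing Implicit Defensive.

Import Order.TTheory GRing.Theory Num.Theory.
Import numFieldNormedType.Exports.

Local Open Scope classical_set_scope.
Local Open Scope ring_scope.
Local Open Scope ereal_scope.

(* Put q_t = sum_(n >= 1) (lam t)^n / n! phi^(n), so that
   p^t = q_t / (exp (lam t) - 1), and let M be multiplication by x.  On the
   half-line M is a derivation for the convolution, hence
   M q_(s+d) = ((s+d)/s) (delta + q_d) * M q_s.
   (i) If f is a subexponential density and g = O(f) is integrable, then
   g * M f ~ |g| M f: the factor x in M f kills the contribution where the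
   argument of f is bounded.  Convolving the identity with the inverse
   exp (- lam d phi) of delta + q_d gives
   q_s ~ (s/(s+d)) exp (- lam d) q_(s+d) whenever q_(s+d) is subexponential, and
   the identity itself gives the way from q_s up to q_(2s).
   (ii) If q_(s+d) ~ K q_s with q_s long-tailed, integrating the identity
   against the submultiplicative weights exp (gam x) 1_(x <= X) forces
   K <= ((s+d)/s) exp (lam d), so that q_d * M q_s is asymptotically no larger than
   |q_d| M q_s; this bound propagates to 2d, 4d, ..., and once d >= s it bounds
   the middle part of q_s * q_s, since M (f * f) = 2 f * M f. *)

(** * Convolution of nonnegative functions *)

(** No hypothesis bears on the tail of phi, so the functions q_t are compared with one another, and
    M phi cancels from the identity. The factor (s + d) / s that M brings in is the source of the
    constant t in the theorem: (1 - exp (- lam t)) p^t equals exp (- lam t) q_t, so C (t) = t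
    amounts to q_t ~ t exp (lam (t - 1)) q_1. In (ii) the constant K is unknown at the outset. A
    long-tailed function decays more slowly than every exponential, so its truncated exponential
    moments can be tuned to any size; submultiplicativity turns the identity into an inequality
    between such moments, and as the tilt vanishes q_d enters it only through its mass. Square
    integrability of phi bounds all convolution powers from the second on by one constant, which
    makes every q_t finite at every point, as a density has to be. The convolution calculus uses
    only nonnegative, possibly infinite integrals and series, which can be interchanged freely;
    subtraction is left to values already known to be finite. *)

Definition nn_measurable (R : realType) (f : R -> \bar R) : Prop :=
  (forall x, 0 <= f x) /\ measurable_fun [set: R] f.

(** The factor [c] may be [+oo], hence the detour through the integral for the counting measure. *)
Lemma ge0_nneseriesZl (R : realType) (c : \bar R) (u : nat -> \bar R) :
  0 <= c -> (forall n, 0 <= u n) ->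
  \sum_(0 <= n <oo) (c * u n) = c * \sum_(0 <= n <oo) u n.
Proof.
move=> c0 u0; rewrite -!ge0_integral_count// => [|n]; last exact: mule_ge0.
exact: ge0_integralZl.
Qed.

Section convolution.
Context {R : realType}.
Local Notation mu := (@lebesgue_measure R).
Implicit Types f g h : R -> \bar R.

Lemma measurable_subl (x : R) :
  measurable_fun [set: measurableTypeR R] (fun u : R => x - u : measurableTypeR R)%R.
Proof. exact: measurable_funB. Qed.

(** Uniqueness of Lebesgue measure: the reflection pulls []a, b]] back to an interval of the same
    length. *)
Lemma lebesgue_measure_subl (x : R) (A : set R) : measurable A ->
  pushforward mu ((fun u : R => x - u)%R : _ -> measurableTypeR R) A = mu A.
Proof.
move=> mA; apply/esym.
pose phi := (fun u : R => x - u)%R : measurableTypeR R -> measurableTypeR R.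
have mphi : isMeasurableFun _ _ _ _ phi.
  by constructor; exact: measurable_subl.
pose phi' : {mfun _ >-> _} := HB.pack phi mphi.
apply: (@lebesgue_measure_unique R (pushforward mu phi')) => //= _ [[a b]] _ <-.
rewrite /pushforward/=.
have -> : phi @^-1` `]a, b]%classic = `[(x - b)%R, (x - a)%R[%classic.
  apply/seteqP; split => u /=; rewrite !in_itv/= /phi; lra.
rewrite !lebesgue_measure_itv/= !lte_fin.
have -> : (x - b < x - a)%R = (a < b)%R by rewrite ltrD2l ltrN2.
by case: ifP => // _; congr EFin; lra.
Qed.

Lemma integral_subl f (x : R) : nn_measurable f ->
  \int[mu]_u f (x - u)%R = \int[mu]_u f u.
Proof.
move=> [f0 mf].
have := @ge0_integral_pushforward _ _ _ _ R _ (measurable_subl x) mu setT f measurableT mf.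
rewrite preimage_setT /= => <- //.
apply: eq_measure_integral; first exact: measurable_subl.
move=> ? A mA _.
exact: lebesgue_measure_subl.
Qed.

Lemma nn_measurable_subl f (x : R) : nn_measurable f ->
  nn_measurable (fun u => f (x - u)%R).
Proof.
move=> [f0 mf]; split=> //.
exact: measurableT_comp mf (measurable_subl x).
Qed.

Lemma integral_addr f (x : R) : nn_measurable f ->
  \int[mu]_u f (u + x)%R = \int[mu]_u f u.
Proof.
move=> mf; rewrite -(integral_subl x mf).
rewrite -(integral_subl 0%R (nn_measurable_subl x mf)).
by apply: eq_integral => u _; congr f; lra.
Qed.

Lemma nn_measurableM f g : nn_measurable f -> nn_measurable g ->
  nn_measurable (fun x => f x * g x).
Proof.
move=> [f0 mf] [g0 mg]; split=> [x|]; first exact: mule_ge0.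
exact: emeasurable_funM.
Qed.

Lemma nn_measurableD f g : nn_measurable f -> nn_measurable g ->
  nn_measurable (fun x => f x + g x).
Proof.
move=> [f0 mf] [g0 mg]; split=> [x|]; first exact: adde_ge0.
exact: emeasurable_funD.
Qed.

Lemma nn_measurableZ (c : R) f : (0 <= c)%R -> nn_measurable f ->
  nn_measurable (fun x => c%:E * f x).
Proof.
move=> c0 mf; apply: nn_measurableM => //; split => // x.
Qed.

Lemma nn_integralZl (c : R) f : (0 <= c)%R -> nn_measurable f ->
  \int[mu]_x (c%:E * f x) = c%:E * \int[mu]_x f x.
Proof. by move=> c0 mf; rewrite ge0_integralZl//; [exact: mf.2|move=> x _; exact: mf.1]. Qed.

Lemma nn_integralD f g : nn_measurable f -> nn_measurable g ->
  \int[mu]_x (f x + g x) = \int[mu]_x f x + \int[mu]_x g x.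
Proof.
move=> mf mg; rewrite ge0_integralD//; [by move=> x _; exact: mf.1|exact: mf.2|
  by move=> x _; exact: mg.1|exact: mg.2].
Qed.

Lemma nn_le_integral f g : nn_measurable f -> nn_measurable g ->
  (forall x, f x <= g x) -> \int[mu]_x f x <= \int[mu]_x g x.
Proof.
move=> mf mg fg; apply: ge0_le_integral => //; [by move=> x _; exact: mf.1|exact: mf.2|exact: mg.2].
Qed.

Lemma nn_integral_ge0 f : nn_measurable f -> 0 <= \int[mu]_x f x.
Proof. by move=> mf; apply: integral_ge0 => x _; exact: mf.1. Qed.

Lemma nn_measurable_nneseries (h : nat -> R -> \bar R) :
  (forall n, nn_measurable (h n)) ->
  nn_measurable (fun x => \sum_(0 <= n <oo) h n x).
Proof.
move=> mh; split=> [x|].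
  by apply: nneseries_ge0 => n _ _; exact: (mh n).1.
by apply: ge0_emeasurable_sum => [n x _ _|n _]; [exact: (mh n).1|exact: (mh n).2].
Qed.

Lemma measurable_conv_integrand f g : nn_measurable f -> nn_measurable g ->
  measurable_fun [set: R * R] (fun z : R * R => f (z.1 - z.2)%R * g z.2).
Proof.
move=> [f0 mf] [g0 mg]; apply: emeasurable_funM.
  by apply: (measurableT_comp mf); exact: measurable_funB.
exact: (measurableT_comp mg).
Qed.

Lemma nn_measurable_conv f g : nn_measurable f -> nn_measurable g ->
  nn_measurable (convolution f g).
Proof.
move=> mf mg; split=> [x|].
  by apply: integral_ge0 => u _; apply: mule_ge0; [exact: mf.1|exact: mg.1].
apply: (measurable_fun_fubini_tonelli_F (m2 := mu)
  (fun z : R * R => f (z.1 - z.2)%R * g z.2)).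
  exact: measurable_conv_integrand.
by move=> z; apply: mule_ge0; [exact: mf.1|exact: mg.1].
Qed.

Lemma nn_measurable_conv_integrand f g x : nn_measurable f -> nn_measurable g ->
  nn_measurable (fun u => f (x - u)%R * g u).
Proof. by move=> mf mg; apply: nn_measurableM => //; exact: nn_measurable_subl. Qed.

Lemma convC f g : nn_measurable f -> nn_measurable g ->
  convolution f g = convolution g f.
Proof.
move=> mf mg; apply/funext => x; rewrite /convolution.
rewrite -(integral_subl x (nn_measurable_conv_integrand x mf mg)).
by apply: eq_integral => u _; rewrite muleC subKr.
Qed.

(** Tonelli exchanges the two integrations; translating the inner variable by v then exposes the
    inner convolution. *)
Lemma convA f g h : nn_measurable f -> nn_measurable g -> nn_measurable h ->
  convolution f (convolution g h) = convolution (convolution f g) h.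
Proof.
move=> mf mg mh; apply/funext => x; rewrite /convolution.
transitivity (\int[mu]_u \int[mu]_v (f (x - u)%R * (g (u - v)%R * h v))).
  apply: eq_integral => u _; rewrite ge0_integralZl//.
  - exact: (nn_measurable_conv_integrand u mg mh).2.
  - by move=> v _; exact: (nn_measurable_conv_integrand u mg mh).1.
  - exact: mf.1.
rewrite (fubini_tonelli (m1 := mu) (m2 := mu)
  (fun z : R * R => f (x - z.1)%R * (g (z.1 - z.2)%R * h z.2)))/=; last 2 first.
- apply: emeasurable_funM; last exact: measurable_conv_integrand.
  exact: (measurableT_comp (nn_measurable_subl x mf).2).
- by move=> z; rewrite !mule_ge0 ?mf.1 ?mg.1 ?mh.1.
apply: eq_integral => v _.
under eq_integral do rewrite muleA.
have mk : nn_measurable (fun u => f (x - u)%R * g (u - v)%R).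
  apply: nn_measurableM; first exact: nn_measurable_subl.
  by split=> [u|]; [exact: mg.1 | apply: (measurableT_comp mg.2); exact: measurable_funB].
rewrite ge0_integralZr; [|exact: measurableT|exact: mk.2|by move=> u _; exact: mk.1|exact: mh.1].
congr (_ * _); rewrite -(integral_addr v mk).
by apply: eq_integral => u _; congr (f _ * g _); lra.
Qed.

Lemma integral_conv f g : nn_measurable f -> nn_measurable g ->
  \int[mu]_x convolution f g x = \int[mu]_x f x * \int[mu]_x g x.
Proof.
move=> mf mg; rewrite /convolution.
rewrite (fubini_tonelli (m1 := mu) (m2 := mu)
  (fun z : R * R => f (z.1 - z.2)%R * g z.2))/=; last 2 first.
- exact: measurable_conv_integrand.
- by move=> z; rewrite !mule_ge0 ?mf.1 ?mg.1.
rewrite -ge0_integralZl//; [|exact: mg.2|by move=> x _; exact: mg.1|]; last first.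
  by apply: integral_ge0 => x _; exact: mf.1.
apply: eq_integral => u _.
rewrite ge0_integralZr//; last 3 first.
- by apply: (measurableT_comp mf.2); exact: measurable_funB.
- by move=> x _; exact: mf.1.
- exact: mg.1.
by congr (_ * _); exact: (integral_addr (- u)%R mf).
Qed.

Lemma convDr f g h : nn_measurable f -> nn_measurable g -> nn_measurable h ->
  convolution f (fun x => g x + h x) =
  (fun x => convolution f g x + convolution f h x).
Proof.
move=> mf mg mh; apply/funext => x.
have mfg := nn_measurable_conv_integrand x mf mg.
have mfh := nn_measurable_conv_integrand x mf mh.
rewrite /convolution -ge0_integralD//; [|by move=> u _; exact: mfg.1|exact: mfg.2
  |by move=> u _; exact: mfh.1|exact: mfh.2].
by apply: eq_integral => u _; rewrite ge0_muleDr ?mg.1 ?mh.1.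
Qed.

Lemma convDl f g h : nn_measurable f -> nn_measurable g -> nn_measurable h ->
  convolution (fun x => f x + g x) h =
  (fun x => convolution f h x + convolution g h x).
Proof.
move=> mf mg mh; rewrite convC//; last exact: nn_measurableD.
by rewrite convDr// (convC mh mf) (convC mh mg).
Qed.

Lemma convZr c f g : (0 <= c)%R -> nn_measurable f -> nn_measurable g ->
  convolution f (fun x => c%:E * g x) = (fun x => c%:E * convolution f g x).
Proof.
move=> c0 mf mg; apply/funext => x.
have mfg := nn_measurable_conv_integrand x mf mg.
rewrite /convolution -ge0_integralZl//; [|exact: mfg.2|by move=> u _; exact: mfg.1].
by apply: eq_integral => u _; rewrite muleCA.
Qed.

Lemma convZl c f g : (0 <= c)%R -> nn_measurable f -> nn_measurable g ->
  convolution (fun x => c%:E * f x) g = (fun x => c%:E * convolution f g x).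
Proof.
move=> c0 mf mg; rewrite convC//; last exact: nn_measurableZ.
by rewrite convZr// (convC mg mf).
Qed.

Lemma conv_nneseriesr f (h : nat -> R -> \bar R) :
  nn_measurable f -> (forall n, nn_measurable (h n)) ->
  convolution f (fun x => \sum_(0 <= n <oo) h n x) =
  (fun x => \sum_(0 <= n <oo) convolution f (h n) x).
Proof.
move=> mf mh; apply/funext => x; rewrite /convolution.
rewrite -integral_nneseries//; last 2 first.
- by move=> n; exact: (nn_measurable_conv_integrand x mf (mh n)).2.
- by move=> n u _; exact: (nn_measurable_conv_integrand x mf (mh n)).1.
apply: eq_integral => u _; rewrite ge0_nneseriesZl//; first exact: mf.1.
by move=> n; exact: (mh n).1.
Qed.

Lemma le_conv f f' g g' : nn_measurable f -> nn_measurable g ->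
  nn_measurable f' -> nn_measurable g' ->
  (forall x, f x <= f' x) -> (forall x, g x <= g' x) ->
  forall x, convolution f g x <= convolution f' g' x.
Proof.
move=> mf mg mf' mg' ff' gg' x; apply: ge0_le_integral => //.
- by move=> u _; exact: (nn_measurable_conv_integrand x mf mg).1.
- exact: (nn_measurable_conv_integrand x mf mg).2.
- exact: (nn_measurable_conv_integrand x mf' mg').2.
- by move=> u _; apply: lee_pmul; rewrite ?mf.1 ?mg.1.
Qed.

End convolution.

(** * The half-line and power series in convolution *)

Definition half_line (R : realType) (f : R -> \bar R) : Prop :=
  nn_measurable f /\ forall x, (x < 0)%R -> f x = 0.

(* [max x 0] rather than [x] keeps the product nonnegative everywhere. *)
Definition xmul (R : realType) (f : R -> \bar R) : R -> \bar R :=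
  fun x => (Num.max x 0)%:E * f x.

Section half_line.
Context {R : realType}.
Local Notation mu := (@lebesgue_measure R).
Implicit Types f g h : R -> \bar R.

Lemma half_lineD f g : half_line f -> half_line g ->
  half_line (fun x => f x + g x).
Proof.
move=> [mf f0] [mg g0]; split; first exact: nn_measurableD.
by move=> x x0; rewrite f0// g0// adde0.
Qed.

Lemma half_lineZ (c : R) f : (0 <= c)%R -> half_line f ->
  half_line (fun x => c%:E * f x).
Proof.
move=> c0 [mf f0]; split; first exact: nn_measurableZ.
by move=> x x0; rewrite f0// mule0.
Qed.

Lemma maxr0_ge0 (x : R) : 0 <= (Num.max x 0)%:E.
Proof. by rewrite lee_fin le_max lexx orbT. Qed.

Lemma half_line_xmul f : half_line f -> half_line (xmul f).
Proof.
move=> [mf f0]; split.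
  apply: nn_measurableM => //; split => [x|]; first exact: maxr0_ge0.
  apply/measurable_EFinP; exact: measurable_maxr.
by move=> x x0; rewrite /xmul f0// mule0.
Qed.

Lemma half_line_nneseries (h : nat -> R -> \bar R) :
  (forall n, half_line (h n)) ->
  half_line (fun x => \sum_(0 <= n <oo) h n x).
Proof.
move=> hh; split; first by apply: nn_measurable_nneseries => n; exact: (hh n).1.
by move=> x x0; apply: eseries0 => i _ _; exact: (hh i).2.
Qed.

Lemma half_line_conv f g : half_line f -> half_line g ->
  half_line (convolution f g).
Proof.
move=> [mf f0] [mg g0]; split; first exact: nn_measurable_conv.
move=> x x0; apply: integral0_eq => u _.
have [u0|u0] := ltP u 0%R; first by rewrite g0// mule0.
by rewrite f0 ?mul0e//; lra.
Qed.

(** Leibniz rule: where the integrand is nonzero, x = (x - u) + u with both terms nonnegative, so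
    that every [max] disappears. *)
Lemma xmul_conv f g : half_line f -> half_line g ->
  xmul (convolution f g) =
  (fun x => convolution (xmul f) g x + convolution f (xmul g) x).
Proof.
move=> hf hg; apply/funext => x.
have i1 := nn_measurable_conv_integrand x (half_line_xmul hf).1 hg.1.
have i2 := nn_measurable_conv_integrand x hf.1 (half_line_xmul hg).1.
have i := nn_measurable_conv_integrand x hf.1 hg.1.
rewrite /xmul /convolution -ge0_integralD//; first last.
- exact: i2.2.
- by move=> u _; exact: i2.1.
- exact: i1.2.
- by move=> u _; exact: i1.1.
rewrite -ge0_integralZl//; [|exact: i.2|by move=> u _; exact: i.1|]; last first.
  exact: maxr0_ge0.
apply: eq_integral => u _.
have [u0|u0] := ltP u 0%R; first by rewrite (hg.2 _ u0) !mule0 adde0.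
have [xu|xu] := ltP (x - u)%R 0%R.
  by rewrite (hf.2 _ xu) mule0 !mul0e mule0 adde0.
rewrite -muleA (muleCA (f _)) -ge0_muleDl.
- by rewrite -EFinD; congr (_%:E * _); rewrite /Num.max; case: ltrP; lra.
- by rewrite lee_fin.
- by rewrite lee_fin.
Qed.

End half_line.

Section conv_series.
Context {R : realType}.
Local Notation mu := (@lebesgue_measure R).
Variable phi : R -> \bar R.
Hypothesis hphi : half_line phi.
Implicit Types (f g h : R -> \bar R) (a b c : nat -> R).

(** The index counts the factors convolved onto [f], so [conv_iter n phi] is the convolution power
    of order [n.+1]. *)
Definition conv_iter n f := iter n (convolution phi) f.

(** The power series sum_n c_n phi^(n), with phi^(0) = delta, encoded by its action on [f]: delta is
    not a function, but convolution with it is the identity. *)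
Definition conv_series c f : R -> \bar R :=
  fun x => \sum_(0 <= n <oo) ((c n)%:E * conv_iter n f x).

Definition cauchy_prod a b n : R := (\sum_(i < n.+1) a i * b (n - i)%N)%R.

Lemma half_line_conv_iter n f : half_line f -> half_line (conv_iter n f).
Proof. by move=> hf; elim: n => [//|n ih]; exact: half_line_conv. Qed.

Lemma conv_iterD m n f : conv_iter (m + n) f = conv_iter m (conv_iter n f).
Proof. exact: iterD. Qed.

Lemma half_line_conv_series c f : (forall n, 0 <= c n)%R -> half_line f ->
  half_line (conv_series c f).
Proof.
move=> c0 hf; apply: half_line_nneseries => n.
by apply: half_lineZ => //; exact: half_line_conv_iter.
Qed.

Lemma conv_conv_series g c f : (forall n, 0 <= c n)%R -> half_line f ->
  half_line g -> convolution g (conv_series c f) =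
  fun x => \sum_(0 <= n <oo) ((c n)%:E * convolution g (conv_iter n f) x).
Proof.
move=> c0 hf hg; rewrite conv_nneseriesr; last 2 first.
- exact: hg.1.
- by move=> n; apply: (half_lineZ (c0 n) (half_line_conv_iter n hf)).1.
apply/funext => x; apply: eq_eseriesr => n _.
by rewrite convZr//; [exact: hg.1|exact: (half_line_conv_iter n hf).1].
Qed.

Lemma conv_iter_series m c f : (forall n, 0 <= c n)%R -> half_line f ->
  conv_iter m (conv_series c f) =
  fun x => \sum_(0 <= n <oo) ((c n)%:E * conv_iter (m + n) f x).
Proof.
move=> c0 hf; elim: m => [//|m ih].
rewrite [LHS]/= ih; apply/funext => x.
have := @conv_conv_series phi c (conv_iter m f) c0 (half_line_conv_iter m hf) hphi.
rewrite /conv_series; under eq_fun do under eq_eseriesr do rewrite -conv_iterD addnC.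
move=> -> ; apply: eq_eseriesr => n _.
by rewrite -conv_iterD addnC.
Qed.

Lemma cauchy_prod_ge0 a b : (forall n, 0 <= a n)%R -> (forall n, 0 <= b n)%R ->
  (forall n, 0 <= cauchy_prod a b n)%R.
Proof. by move=> a0 b0 n; apply: sumr_ge0 => i _; rewrite mulr_ge0. Qed.

(** Power series in phi compose like formal power series; nonnegativity of the coefficients
    justifies summing along antidiagonals. *)
Lemma conv_series_comp a b f : (forall n, 0 <= a n)%R -> (forall n, 0 <= b n)%R ->
  half_line f ->
  conv_series a (conv_series b f) = conv_series (cauchy_prod a b) f.
Proof.
move=> a0 b0 hf; apply/funext => x; rewrite /conv_series.
(* Setting the terms with i > n to zero lets both summations run over all indices before they are
   interchanged. *)
pose t i n := if (i <= n)%N then (a i * b (n - i)%N)%:E * conv_iter n f x else 0.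
have t0 i n : 0 <= t i n.
  rewrite /t; case: ifP => // _; rewrite mule_ge0 ?lee_fin ?mulr_ge0//.
  exact: (half_line_conv_iter n hf).1.1.
transitivity (\sum_(0 <= i <oo) \sum_(0 <= n <oo) t i n).
  apply: eq_eseriesr => i _.
  rewrite (@nneseries_split _ _ 0 i)// add0n [X in _ = X + _]big1_seq ?add0e; last first.
    by move=> j /andP[_]; rewrite mem_index_iota /= => ji; rewrite /t leqNgt ji.
  rewrite -/(conv_series _ _) conv_iter_series// -nneseries_addn//.
  rewrite -nneseriesZl; last first.
    by move=> n _; rewrite mule_ge0 ?lee_fin//; exact: (half_line_conv_iter _ hf).1.1.
  apply: eq_eseriesr => n _.
  by rewrite /t leq_addl addnK muleA -EFinM addnC.
rewrite nneseries_interchange//; apply: eq_eseriesr => n _.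
rewrite (@nneseries_split _ _ 0 n.+1)// add0n [X in _ + X]eseries0 ?adde0; last first.
  by move=> i ni _; rewrite /t leqNgt ni.
rewrite big_mkord /cauchy_prod -sumEFin ge0_sume_distrl; last first.
  by move=> i _; rewrite lee_fin mulr_ge0.
by apply: eq_bigr => i _; rewrite /t -ltnS ltn_ord.
Qed.

Lemma eq_conv_series a b f : a =1 b -> conv_series a f = conv_series b f.
Proof. by move=> /funext ->. Qed.

Lemma conv_seriesD a b f : (forall n, 0 <= a n)%R -> (forall n, 0 <= b n)%R ->
  half_line f -> conv_series (fun n => a n + b n)%R f =
  fun x => conv_series a f x + conv_series b f x.
Proof.
move=> a0 b0 hf; apply/funext => x; rewrite /conv_series -nneseriesD; last 2 first.
- by move=> n _ _; rewrite mule_ge0 ?lee_fin//; exact: (half_line_conv_iter _ hf).1.1.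
- by move=> n _ _; rewrite mule_ge0 ?lee_fin//; exact: (half_line_conv_iter _ hf).1.1.
by apply: eq_eseriesr => n _; rewrite EFinD ge0_muleDl ?lee_fin.
Qed.

Lemma conv_seriesZ (k : R) a f : (0 <= k)%R -> (forall n, 0 <= a n)%R ->
  half_line f -> conv_series (fun n => k * a n)%R f =
  fun x => k%:E * conv_series a f x.
Proof.
move=> k0 a0 hf; apply/funext => x; rewrite /conv_series -nneseriesZl; last first.
  by move=> n _; rewrite mule_ge0 ?lee_fin//; exact: (half_line_conv_iter _ hf).1.1.
by apply: eq_eseriesr => n _; rewrite EFinM muleA.
Qed.

Lemma conv_series_delta0 f : half_line f ->
  conv_series (fun n => (n == 0%N)%:R) f = f.
Proof.
move=> hf; apply/funext => x; rewrite /conv_series nneseries_recl//=; last first.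
  by move=> n _; rewrite mule_ge0 ?lee_fin//; exact: (half_line_conv_iter _ hf).1.1.
rewrite mul1e eseries0 ?adde0// => -[//|n] _ _.
by rewrite mul0e.
Qed.

Lemma conv_seriesZr (k : R) a f : (0 <= k)%R -> (forall n, 0 <= a n)%R ->
  half_line f -> conv_series a (fun x => k%:E * f x) =
  fun x => k%:E * conv_series a f x.
Proof.
move=> k0 a0 hf; rewrite -conv_seriesZ//; apply/funext => x.
apply: eq_eseriesr => n _.
have -> : conv_iter n (fun x => k%:E * f x) = fun x => k%:E * conv_iter n f x.
  elim: n => [//|n ih]; rewrite [LHS]/= ih convZr//; first exact: hphi.1.
  exact: (half_line_conv_iter _ hf).1.
by rewrite muleA -EFinM mulrC.
Qed.

Lemma conv_iter_phi n f : half_line f ->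
  convolution (conv_iter n phi) f = conv_iter n.+1 f.
Proof.
move=> hf; elim: n => [//|n ih].
rewrite [LHS]/= -convA; [by rewrite ih|exact: hphi.1| |exact: hf.1].
exact: (half_line_conv_iter _ hphi).1.
Qed.

(** Splits off the delta term. What remains is convolution with a genuine function, to which tail
    estimates apply. *)
Lemma conv_seriesE c f : (forall n, 0 <= c n)%R -> half_line f ->
  conv_series c f = fun x => (c 0%N)%:E * f x +
    convolution (conv_series (fun n => c n.+1) phi) f x.
Proof.
move=> c0 hf; apply/funext => x; rewrite /conv_series nneseries_recl//=; last first.
  by move=> n _; rewrite mule_ge0 ?lee_fin//; exact: (half_line_conv_iter _ hf).1.1.
congr (_ + _); rewrite -nneseries_addn; last first.
  by move=> n; rewrite mule_ge0 ?lee_fin//; exact: (half_line_conv_iter _ hf).1.1.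
have hs := half_line_conv_series (fun n => c0 n.+1) hphi.
rewrite convC; [|exact: hs.1|exact: hf.1].
rewrite conv_conv_series//.
apply: eq_eseriesr => n _; rewrite addn1 -conv_iter_phi//.
rewrite (convC hf.1)//; exact: (half_line_conv_iter _ hphi).1.
Qed.

Lemma le_conv_series a b f : (forall n, 0 <= a n <= b n)%R -> half_line f ->
  forall x, conv_series a f x <= conv_series b f x.
Proof.
move=> ab hf x; have fn n := (half_line_conv_iter n hf).1.1.
apply: lee_nneseries => [n _ _|n _]; have /andP[a0 abn] := ab n.
  by rewrite mule_ge0.
by rewrite lee_wpmul2r// lee_fin.
Qed.

(** By the Leibniz rule each of the [n.+1] factors phi contributes the same term. *)
Lemma xmul_conv_iter n :
  xmul (conv_iter n phi) = fun x => n.+1%:R%:E * conv_iter n (xmul phi) x.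
Proof.
have hx := half_line_xmul hphi.
elim: n => [|n ih]; first by apply/funext => x; rewrite mul1e.
rewrite [X in xmul X]/= xmul_conv//; last exact: half_line_conv_iter.
rewrite ih convZr//; [|exact: hphi.1|exact: (half_line_conv_iter _ hx).1].
rewrite convC; [|exact: hx.1|exact: (half_line_conv_iter _ hphi).1].
rewrite conv_iter_phi//; apply/funext => x.
have p0 := (half_line_conv_iter n.+1 hx).1.1 x.
by rewrite -{1}[conv_iter _ _ _]mul1e -ge0_muleDl// -EFinD -nat1r.
Qed.

Lemma xmul_conv_series c : (forall n, 0 <= c n)%R ->
  xmul (conv_series c phi) = conv_series (fun n => n.+1%:R * c n)%R (xmul phi).
Proof.
move=> c0; have hx := half_line_xmul hphi.
apply/funext => x; rewrite /xmul /conv_series -nneseriesZl; last first.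
  by move=> n _; rewrite mule_ge0 ?lee_fin//; exact: (half_line_conv_iter _ hphi).1.1.
apply: eq_eseriesr => n _.
rewrite muleCA -/(xmul (conv_iter n phi) x) xmul_conv_iter.
by rewrite mulrC EFinM muleA.
Qed.

Hypothesis phi1 : \int[mu]_x phi x = 1.

Lemma integral_conv_iter n f : half_line f ->
  \int[mu]_x conv_iter n f x = \int[mu]_x f x.
Proof.
move=> hf; elim: n => [//|n ih].
rewrite [LHS]integral_conv ?phi1 ?mul1e//; first exact: hphi.1.
exact: (half_line_conv_iter _ hf).1.
Qed.

Lemma integral_conv_series c f : (forall n, 0 <= c n)%R -> half_line f ->
  \int[mu]_x conv_series c f x =
  (\sum_(0 <= n <oo) (c n)%:E) * \int[mu]_x f x.
Proof.
move=> c0 hf; have hn n := half_line_conv_iter n hf.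
rewrite integral_nneseries//; last 2 first.
- by move=> n; exact: (half_lineZ (c0 n) (hn n)).1.2.
- by move=> n x _; exact: (half_lineZ (c0 n) (hn n)).1.1.
rewrite muleC -ge0_nneseriesZl//; last by apply: integral_ge0 => x _; exact: hf.1.1.
apply: eq_eseriesr => n _; rewrite ge0_integralZl//; [|exact: (hn n).1.2|by move=> x _; exact: (hn n).1.1|by rewrite lee_fin].
by rewrite integral_conv_iter// muleC.
Qed.

End conv_series.

(** * Compound Poisson densities *)

Section compound_poisson.
Context {R : realType}.
Local Notation mu := (@lebesgue_measure R).
Variables (lam : R) (phi : R -> \bar R).
Hypothesis lam_gt0 : (0 < lam)%R.
Hypothesis hphi : half_line phi.
Implicit Types (f g h : R -> \bar R) (s t d : R).

Local Notation conv_series := (conv_series phi).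

(** Poisson weights without exp (- lam t): the coefficients of exp (lam t phi). Negative [t] is
    allowed, since [pois (- d)] gives the inverse series. *)
Definition pois t n : R := ((lam * t) ^+ n / n`!%:R)%R.

(* The unnormalized density [(expR (lam * t) - 1) * p^t]. *)
Definition cpois t : R -> \bar R := conv_series (fun n => pois t n.+1) phi.

Lemma pois_ge0 t n : (0 <= t)%R -> (0 <= pois t n)%R.
Proof. by move=> t0; rewrite divr_ge0// exprn_ge0// mulr_ge0// ltW. Qed.

Lemma pois0 t : pois t 0 = 1%R.
Proof. by rewrite /pois expr0 fact0 divr1. Qed.

Lemma nneseries_pois t : (0 <= t)%R ->
  \sum_(0 <= n <oo) (pois t n)%:E = (expR (lam * t))%:E.
Proof.
move=> t0; apply/cvg_lim => //.
under eq_fun do rewrite sumEFin.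
apply: cvg_EFin; first by near=> n.
exact: is_cvg_series_exp_coeff.
Unshelve. all: by end_near. Qed.

Lemma nneseries_poisS t : (0 <= t)%R ->
  \sum_(0 <= n <oo) (pois t n.+1)%:E = (expR (lam * t) - 1)%:E.
Proof.
move=> t0; have := nneseries_pois t0.
rewrite nneseries_recl//=; last by move=> n _; rewrite lee_fin pois_ge0.
rewrite -nneseries_addn; last by move=> n; rewrite lee_fin pois_ge0.
under eq_eseriesr do rewrite addn1.
rewrite pois0 => h; rewrite EFinB -h addeAC subee// add0e//.
Qed.

Lemma half_line_cpois t : (0 <= t)%R -> half_line (cpois t).
Proof. by move=> t0; apply: half_line_conv_series => // n; exact: pois_ge0. Qed.

Lemma cpoisson_densityE t : (0 <= t)%R -> cpoisson_density lam phi t =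
  fun x => ((expR (lam * t) - 1)^-1)%:E * cpois t x.
Proof.
move=> t0; apply/funext => x; congr (_ * _).
rewrite -(@nneseries_addn _ (fun n => ((lam * t) ^+ n / n`!%:R)%:E * conv_pow phi n x)).
  by apply: eq_eseriesr => n _; rewrite addn1.
move=> n; rewrite mule_ge0 ?lee_fin ?pois_ge0//.
exact: (half_line_conv_iter hphi _ hphi).1.1.
Qed.

Lemma cauchy_prod_pois s t : cauchy_prod (pois s) (pois t) =1 pois (s + t).
Proof.
move=> n; rewrite /cauchy_prod /pois mulrDr addrC exprDn mulr_suml.
apply: eq_bigr => i _; have i_n : (i <= n)%N by rewrite -ltnS.
rewrite -(bin_fact i_n) -mulr_natr !natrM.
have nz k : (k`!%:R != 0 :> R)%R by rewrite pnatr_eq0 -lt0n fact_gt0.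
have bz : ('C(n, i)%:R != 0 :> R)%R by rewrite pnatr_eq0 -lt0n bin_gt0.
by field; rewrite !nz bz.
Qed.

(** Differentiating the exponential series: the factor [n.+1] cancels against the factorial and
    lowers the index by one, which brings back the delta term. *)
Lemma xmul_cpois t : (0 <= t)%R ->
  xmul (cpois t) = fun x => (lam * t)%:E * conv_series (pois t) (xmul phi) x.
Proof.
move=> t0; rewrite xmul_conv_series//; last by move=> n; exact: pois_ge0.
rewrite -conv_seriesZ//; [|by rewrite mulr_ge0// ltW|by move=> n; exact: pois_ge0
  |exact: half_line_xmul].
apply: eq_conv_series => n; rewrite /pois factS natrM exprS.
have nz k : (k`!%:R != 0 :> R)%R by rewrite pnatr_eq0 -lt0n fact_gt0.
by field; rewrite nz addrC natr1 pnatr_eq0.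
Qed.

Lemma conv_series_pois t f : (0 <= t)%R -> half_line f ->
  conv_series (pois t) f = fun x => f x + convolution (cpois t) f x.
Proof.
move=> t0 hf; rewrite conv_seriesE//; last by move=> n; exact: pois_ge0.
by apply/funext => x; rewrite pois0 mul1e.
Qed.

(** Both sides are multiples of exp (lam (s + d) phi) acting on M phi, because the exponentials
    compose; (s + d) / s is the quotient of the prefactors lam (s + d) and lam s. *)
Lemma xmul_cpoisD_series s d : (0 < s)%R -> (0 <= d)%R ->
  xmul (cpois (s + d)) =
  fun x => ((s + d) / s)%:E * conv_series (pois d) (xmul (cpois s)) x.
Proof.
move=> s0 d0; have hx := half_line_xmul hphi.
have sn n : (0 <= pois s n)%R by rewrite pois_ge0// ltW.
have dn n : (0 <= pois d n)%R by rewrite pois_ge0.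
have ls : (0 <= lam * s)%R by rewrite mulr_ge0// ltW.
rewrite !xmul_cpois ?addr_ge0 ?(ltW s0)//.
rewrite conv_seriesZr//; last exact: half_line_conv_series.
rewrite conv_series_comp//; apply/funext => x.
rewrite muleA -EFinM addrC -(eq_conv_series _ _ (cauchy_prod_pois d s)).
by congr (_%:E * _); field; rewrite gt_eqF.
Qed.

Lemma xmul_cpoisD s d : (0 < s)%R -> (0 <= d)%R ->
  xmul (cpois (s + d)) = fun x => ((s + d) / s)%:E *
    (xmul (cpois s) x + convolution (cpois d) (xmul (cpois s)) x).
Proof.
move=> s0 d0; rewrite xmul_cpoisD_series//; apply/funext => x.
by rewrite conv_series_pois//; apply: half_line_xmul; apply: half_line_cpois; exact: ltW.
Qed.

Lemma le_pois s t n : (0 <= s)%R -> (s <= t)%R -> (pois s n <= pois t n)%R.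
Proof.
move=> s0 st; have t0 := le_trans s0 st.
rewrite ler_wpM2r ?invr_ge0// lerXn2r ?nnegrE ?mulr_ge0 ?(ltW lam_gt0)//.
by rewrite ler_wpM2l// ltW.
Qed.

Lemma le_cpois s t x : (0 <= s)%R -> (s <= t)%R -> cpois s x <= cpois t x.
Proof.
move=> s0 st; apply: le_conv_series => // n.
by rewrite pois_ge0// le_pois.
Qed.

Definition pois_even d n : R := if odd n then 0%R else pois d n.
Definition pois_odd d n : R := if odd n then pois d n else 0%R.

(* cosh(z) e^z = 1 + sinh(z) e^z *)
Lemma cauchy_prod_pois_even d n : cauchy_prod (pois_even d) (pois d) n =
  ((n == 0%N)%:R + cauchy_prod (pois_odd d) (pois d) n)%R.
Proof.
apply/eqP; rewrite -subr_eq; apply/eqP.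
rewrite /cauchy_prod -sumrB.
transitivity (cauchy_prod (pois (- d)) (pois d) n).
  apply: eq_bigr => i _; rewrite -mulrBl; congr (_ * _)%R.
  rewrite /pois_even /pois_odd /pois mulrN exprNn -signr_odd.
  by case: (odd i); rewrite ?expr0 ?expr1; ring.
rewrite cauchy_prod_pois addNr /pois mulr0.
by case: n => [|n]; rewrite ?expr0 ?fact0 ?divr1// expr0n mul0r.
Qed.

(* The inverse of [delta + cpois d], written as a difference of two
   nonnegative functions in order to stay among nonnegative integrals. *)
Definition cpois_cosh d := conv_series (fun n => pois_even d n.+1) phi.
Definition cpois_sinh d := conv_series (fun n => pois_odd d n.+1) phi.

Lemma pois_even_ge0 d n : (0 <= d)%R -> (0 <= pois_even d n)%R.
Proof. by move=> d0; rewrite /pois_even; case: ifP => // _; exact: pois_ge0. Qed.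

Lemma pois_odd_ge0 d n : (0 <= d)%R -> (0 <= pois_odd d n)%R.
Proof. by move=> d0; rewrite /pois_odd; case: ifP => // _; exact: pois_ge0. Qed.

Lemma half_line_cpois_cosh d : (0 <= d)%R -> half_line (cpois_cosh d).
Proof. by move=> d0; apply: half_line_conv_series => // n; exact: pois_even_ge0. Qed.

Lemma half_line_cpois_sinh d : (0 <= d)%R -> half_line (cpois_sinh d).
Proof. by move=> d0; apply: half_line_conv_series => // n; exact: pois_odd_ge0. Qed.

Lemma cpois_cosh_le d x : (0 <= d)%R -> cpois_cosh d x <= cpois d x.
Proof.
move=> d0; apply: le_conv_series => // n.
by rewrite pois_even_ge0//= /pois_even; case: ifP => // _; exact: pois_ge0.
Qed.

Lemma cpois_sinh_le d x : (0 <= d)%R -> cpois_sinh d x <= cpois d x.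
Proof.
move=> d0; apply: le_conv_series => // n.
by rewrite pois_odd_ge0//= /pois_odd; case: ifP => // _; exact: pois_ge0.
Qed.

Lemma cosh_sinh_series d f : (0 <= d)%R -> half_line f ->
  conv_series (pois_even d) (conv_series (pois d) f) =
  fun x => f x + conv_series (pois_odd d) (conv_series (pois d) f) x.
Proof.
move=> d0 hf.
have en n := pois_even_ge0 n d0; have on n := pois_odd_ge0 n d0.
have pn n := pois_ge0 n d0.
rewrite !conv_series_comp// (eq_conv_series _ _ (cauchy_prod_pois_even d)).
rewrite conv_seriesD//; last exact: cauchy_prod_ge0.
by rewrite conv_series_delta0.
Qed.

Lemma conv_series_pois_even d f : (0 <= d)%R -> half_line f ->
  conv_series (pois_even d) f = fun x => f x + convolution (cpois_cosh d) f x.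
Proof.
move=> d0 hf; rewrite conv_seriesE//; last by move=> n; exact: pois_even_ge0.
by apply/funext => x; rewrite /pois_even/= pois0 mul1e.
Qed.

Lemma conv_series_pois_odd d f : (0 <= d)%R -> half_line f ->
  conv_series (pois_odd d) f = convolution (cpois_sinh d) f.
Proof.
move=> d0 hf; rewrite conv_seriesE//; last by move=> n; exact: pois_odd_ge0.
by apply/funext => x; rewrite /pois_odd/= mul0e add0e.
Qed.

(** exp (- lam d phi) applied to M q_(s+d) gives ((s + d) / s) M q_s; its negative terms are moved
    to the right-hand side. *)
Lemma xmul_cpois_inv s d x : (0 < s)%R -> (0 <= d)%R ->
  xmul (cpois (s + d)) x + convolution (cpois_cosh d) (xmul (cpois (s + d))) x =
  ((s + d) / s)%:E * xmul (cpois s) x +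
  convolution (cpois_sinh d) (xmul (cpois (s + d))) x.
Proof.
move=> s0 d0.
have hxs : half_line (xmul (cpois s)) by apply/half_line_xmul/half_line_cpois/ltW.
have hxsd : half_line (xmul (cpois (s + d))).
  by apply/half_line_xmul/half_line_cpois; rewrite addr_ge0// ltW.
have k0 : (0 <= (s + d) / s)%R by rewrite divr_ge0 ?addr_ge0// ltW.
have hse : half_line (conv_series (pois d) (xmul (cpois s))).
  by apply: half_line_conv_series => // n; exact: pois_ge0.
have en n := pois_even_ge0 n d0; have on n := pois_odd_ge0 n d0.
have zr a : (forall n, 0 <= a n)%R -> conv_series a (xmul (cpois (s + d))) x =
    ((s + d) / s)%:E * conv_series a (conv_series (pois d) (xmul (cpois s))) x.
  by move=> a0; rewrite xmul_cpoisD_series// conv_seriesZr.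
have e1 := congr1 (fun f => f x) (conv_series_pois_even d0 hxsd).
have e2 := congr1 (fun f => f x) (cosh_sinh_series d0 hxs).
have e3 := congr1 (fun f => f x) (conv_series_pois_odd d0 hxsd).
rewrite -[LHS]e1 (zr _ en) -[X in _ + X]e3 (zr _ on) e2.
have p1 : 0 <= xmul (cpois s) x := hxs.1.1 x.
have p2 := (half_line_conv_series hphi on hse).1.1 x.
exact: ge0_muleDr.
Qed.

Hypothesis phi1 : \int[mu]_x phi x = 1.

Lemma integral_cpois t : (0 <= t)%R ->
  \int[mu]_x cpois t x = (expR (lam * t) - 1)%:E.
Proof.
move=> t0; rewrite integral_conv_series//; last by move=> n; exact: pois_ge0.
by rewrite phi1 mule1 nneseries_poisS.
Qed.

(** 1 + c - h is the mass of exp (- lam d phi). Instead of summing an alternating series, the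
    cosh-sinh identity is integrated with f = phi: writing E = exp (lam d), this reads (1 + c) E = 1
    + h E. *)
Lemma integral_cosh_sinh d : (0 <= d)%R -> exists c h : R,
  [/\ \int[mu]_x cpois_cosh d x = c%:E, \int[mu]_x cpois_sinh d x = h%:E
   & (1 + c - h = expR (- (lam * d)))%R].
Proof.
move=> d0; have hd := half_line_cpois d0.
have hc := half_line_cpois_cosh d0; have hs := half_line_cpois_sinh d0.
have fin f : half_line f -> (forall x, f x <= cpois d x) ->
    exists c : R, \int[mu]_x f x = c%:E.
  move=> hf fd; exists (fine (\int[mu]_x f x)); rewrite fineK//.
  rewrite ge0_fin_numE; last by apply: integral_ge0 => x _; exact: hf.1.1.
  apply: (@le_lt_trans _ _ (\int[mu]_x cpois d x)).
    apply: ge0_le_integral => //; [by move=> x _; exact: hf.1.1|exact: hf.1.2|exact: hd.1.2].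
  by rewrite integral_cpois// ltry.
have [c ec] := fin _ hc (fun x => cpois_cosh_le x d0).
have [h eh] := fin _ hs (fun x => cpois_sinh_le x d0).
exists c, h; split=> //.
have en n := pois_even_ge0 n d0; have on n := pois_odd_ge0 n d0.
have he : half_line (conv_series (pois d) phi).
  by apply: half_line_conv_series => // n; exact: pois_ge0.
have iE : \int[mu]_x conv_series (pois d) phi x = (expR (lam * d))%:E.
  rewrite (integral_conv_series hphi phi1 (fun n => pois_ge0 n d0) hphi).
  by rewrite phi1 mule1 nneseries_pois.
have hce := half_line_conv hc he; have hse := half_line_conv hs he.
have e1 := congr1 (fun f => \int[mu]_x f x) (conv_series_pois_even d0 he).
have e2 := congr1 (fun f => \int[mu]_x f x) (cosh_sinh_series d0 hphi).
have e3 := congr1 (fun f => \int[mu]_x f x) (conv_series_pois_odd d0 he).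
have hso := half_line_conv_series hphi on he.
have intD f g : half_line f -> half_line g ->
    \int[mu]_x (f x + g x) = \int[mu]_x f x + \int[mu]_x g x.
  move=> hf hg; apply: ge0_integralD => //; [by move=> x _; exact: hf.1.1|
    exact: hf.1.2|by move=> x _; exact: hg.1.1|exact: hg.1.2].
rewrite (intD _ _ he hce) (integral_conv hc.1 he.1) iE ec in e1.
rewrite (intD _ _ hphi hso) phi1 e3 (integral_conv hs.1 he.1) iE eh in e2.
move: e2; rewrite e1 -!EFinM -!EFinD => -[e].
rewrite expRN; have := expR_gt0 (lam * d).
move: (expR _) e => M e M0.
apply: (@mulIf _ M); first by rewrite gt_eqF.
by rewrite mulVf ?gt_eqF//; lra.
Qed.

End compound_poisson.

(** * Pointwise finiteness from square integrability *)

Section finiteness.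
Context {R : realType}.
Local Notation mu := (@lebesgue_measure R).
Variables (lam : R) (phi : R -> \bar R).
Hypothesis lam_gt0 : (0 < lam)%R.
Hypothesis hphi : half_line phi.
Hypothesis phi_fin : forall x, phi x < +oo.
Hypothesis phi1 : \int[mu]_x phi x = 1.
Hypothesis phi_L2 :
  \int[mu]_(x in [set x : R | (0 <= x)%R]) (phi x) ^+ 2 < +oo.

Let K := \int[mu]_x (phi x * phi x).

Let K_fin : K < +oo.
Proof.
rewrite (le_lt_trans _ phi_L2)// integral_mkcond [leRHS]integral_mkcond.
rewrite le_eqVlt; apply/orP; left; apply/eqP; apply: eq_integral => x _.
rewrite !patchE in_setT; case: ifPn => //; rewrite notin_setE/= => /negP.
by rewrite -ltNge => x0; rewrite hphi.2// mule0.
Qed.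

Let nn_sq : nn_measurable (fun x => phi x * phi x).
Proof. by apply: nn_measurableM; exact: hphi.1. Qed.

(** a b <= (a^2 + b^2) / 2 inside the integral; by reflection invariance both squares integrate to
    [K]. *)
Lemma conv_sq_le x : convolution phi phi x <= K.
Proof.
have -> : K = \int[mu]_u (2^-1%:E * (phi (x - u)%R * phi (x - u)%R) +
                         2^-1%:E * (phi u * phi u)).
  have nz := nn_measurable_subl x nn_sq.
  have h0 : (0 <= 2^-1 :> R)%R by [].
  rewrite nn_integralD; [|exact: nn_measurableZ|exact: nn_measurableZ].
  rewrite !nn_integralZl//.
  rewrite (integral_subl x nn_sq) -/K -ge0_muleDl// -EFinD.
  by rewrite (_ : 2^-1 + 2^-1 = 1)%R ?mul1e//; lra.
have m1 := nn_measurable_conv_integrand x hphi.1 hphi.1.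
apply: ge0_le_integral => //.
- by move=> u _; exact: m1.1.
- exact: m1.2.
- apply: emeasurable_funD; apply: emeasurable_funM => //; last exact: nn_sq.2.
  exact: (nn_measurable_subl x nn_sq).2.
move=> u _.
have finE y : exists r : R, phi y = r%:E.
  exists (fine (phi y)); rewrite fineK// ge0_fin_numE//; exact: hphi.1.1.
have [a ->] := finE (x - u)%R; have [b ->] := finE u.
rewrite -!EFinM -EFinD lee_fin; have := sqr_ge0 (a - b)%R; rewrite expr2; lra.
Qed.

(** From the second power on [K] is a bound, preserved by convolution with a probability density.
    The summand [phi x] is there for the first power, as phi may be unbounded. *)
Lemma conv_iter_le n x : conv_iter phi n phi x <= phi x + K.
Proof.
have K0 : 0 <= K by apply: integral_ge0 => u _; exact: nn_sq.1.
case: n => [|n]; first by rewrite leeDl.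
rewrite (le_trans (y := K)) ?leeDr ?hphi.1.1//.
elim: n x => [|n ih] x; first exact: conv_sq_le.
have hn := half_line_conv_iter hphi n.+1 hphi.
have -> : K = K * \int[mu]_u phi (x - u)%R.
  by rewrite (integral_subl x hphi.1) phi1 mule1.
have mx := nn_measurable_subl x hphi.1.
rewrite -ge0_integralZl//; [|exact: mx.2|by move=> u _; exact: mx.1].
have m1 := nn_measurable_conv_integrand x hphi.1 hn.1.
apply: ge0_le_integral => //.
- by move=> u _; exact: m1.1.
- exact: m1.2.
- by apply: emeasurable_funM => //; exact: mx.2.
- by move=> u _; rewrite muleC lee_wpmul2r// ?mx.1//; exact: ih.
Qed.

Lemma cpois_fin t x : (0 <= t)%R -> cpois lam phi t x < +oo.
Proof.
move=> t0; have K0 : 0 <= K by apply: integral_ge0 => u _; exact: nn_sq.1.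
have pn n := pois_ge0 lam_gt0 n.+1 t0.
apply: (@le_lt_trans _ _ (\sum_(0 <= n <oo) ((phi x + K) * (pois lam t n.+1)%:E))).
  apply: lee_nneseries => [n _ _|n _].
    by rewrite mule_ge0 ?lee_fin//; exact: (half_line_conv_iter hphi _ hphi).1.1.
  by rewrite muleC lee_wpmul2r ?lee_fin// conv_iter_le.
have p0 : 0 <= phi x + K by apply: adde_ge0 => //; exact: hphi.1.1.
have pf : phi x + K < +oo by exact: lte_add_pinfty.
rewrite ge0_nneseriesZl// (nneseries_poisS lam_gt0 t0) lte_mul_pinfty ?ltry//.
by rewrite ge0_fin_numE.
Qed.

Lemma cpoisson_density_is_density t : (0 < t)%R ->
  is_density (cpoisson_density lam phi t).
Proof.
move=> t0; rewrite (cpoisson_densityE lam_gt0 hphi (ltW t0)).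
have hq := half_line_cpois lam_gt0 hphi (ltW t0).
have m0 : (0 < expR (lam * t) - 1)%R by rewrite subr_gt0 expR_gt1 mulr_gt0.
have c0 : (0 <= (expR (lam * t) - 1)^-1)%R by rewrite invr_ge0 ltW.
have hz := half_lineZ c0 hq.
split; first split=> [x|]; last 2 first.
- exact: hz.1.2.
- rewrite ge0_integralZl//; [|exact: hq.1.2|by move=> x _; exact: hq.1.1].
  by rewrite (integral_cpois lam_gt0 hphi phi1 (ltW t0)) -EFinM mulVf// gt_eqF.
rewrite hz.1.1/= lte_mul_pinfty// ?lee_fin//.
exact: (cpois_fin _ (ltW t0)).
Qed.

End finiteness.

(** * Long tails *)

Section uniform_convergence.
Context {R : realType}.
Local Notation mu := (@lebesgue_measure R).

Lemma lebesgue_measure_addr (u : R) (A : set R) : measurable A ->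
  mu [set z | A (z - u)%R] = mu A.
Proof.
move=> mA; rewrite -(lebesgue_measure_subl 0%R mA).
have mB : measurable [set y : R | A (0 - y)%R].
  have := measurable_subl (0%R : R) measurableT mA.
  by rewrite setTI.
have := lebesgue_measure_subl u mB.
rewrite /pushforward /preimage /= => <-.
by congr (mu _); apply/seteqP; split => z /=; rewrite sub0r opprB.
Qed.

Lemma not_near_pinfty (P : R -> Prop) : ~ (\forall x \near +oo%R, P x) ->
  forall M : R, exists2 x, (M < x)%R & ~ P x.
Proof.
move=> nP M; apply: contrapT => /forall2NP h; apply: nP.
exists M; split; first exact: num_real.
by move=> x Mx; have [//|/contrapT] := h x.
Qed.

(* Karamata's uniform convergence theorem. If uniformity failed along x_n, u_n,
   the shifts that are good at x_n and, translated by u_n, those that are good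
   at x_n - u_n would eventually have almost full measure, hence a common point. *)
Lemma uniform_long_tailed (r : R -> R) : measurable_fun [set: R] r ->
  (forall x, 0 <= r x)%R ->
  (forall a d : R, (0 < d)%R ->
    \forall x \near +oo%R, ((1 - d) * r x <= r (x - a) <= (1 + d) * r x)%R) ->
  forall A e : R, (0 < e)%R -> \forall x \near +oo%R, forall u : R,
    (0 <= u <= A)%R -> ((1 - e) * r x <= r (x - u) <= (1 + e) * r x)%R.
Proof.
move=> mr r0 rl A0 e0 e0_gt0.
wlog [A_gt0 e_le1] : A0 e0 e0_gt0 / (0 < A0)%R /\ (e0 <= 1)%R.
  move=> /(_ (Num.max A0 1%R) (Num.min e0 1%R)) H.
  have [||] := H; [by rewrite lt_min e0_gt0/=|by rewrite lt_max ltr01 orbT ge_min lexx orbT|].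
  move=> M [rM HM]; exists M; split=> // x Mx u /andP[u0 uA].
  have /andP[h1 h2] : ((1 - Num.min e0 1) * r x <= r (x - u) <= (1 + Num.min e0 1) * r x)%R.
    by apply: HM; rewrite // u0 le_max uA.
  have le1 : (Num.min e0 1 <= e0)%R by rewrite ge_min lexx.
  rewrite (le_trans _ h1) ?(le_trans h2)// ler_wpM2r//; lra.
set A := A0 in A_gt0 *; set e := e0 in e0_gt0 e_le1 *.
apply: contrapT => /not_near_pinfty H.
have /choice [xu Hxu] : forall n : nat, exists p : R * R,
    [/\ (n%:R < p.1)%R, (0 <= p.2 <= A)%R &
     ~~ ((1 - e) * r p.1 <= r (p.1 - p.2) <= (1 + e) * r p.1)%R].
  move=> n; have [x nx] := H n%:R; move=> /existsNP[u /not_implyP[uA]] /negP nu.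
  by exists (x, u).
pose x n := (xu n).1; pose u n := (xu n).2.
have d0 : (0 < e / 4)%R by rewrite divr_gt0.
(* Two comparisons with error d combine into one with error 4 d = e: (1 + d) / (1 - d) <= 1 + 4 d,
   as e <= 1. *)
set d := (e / 4)%R in d0.
pose good (y v : R) := ((1 - d) * r y <= r (y - v) <= (1 + d) * r y)%R.
have cvg_good (y : nat -> R) v : (forall n, n%:R - A <= y n)%R ->
    exists n, forall m, (n <= m)%N -> good (y m) v.
  move=> hy; have [M [_ HM]] := rl v d d0.
  exists (Num.truncn (Num.max 0 (M + A))%R).+1 => m nm; apply: HM.
  have := truncnS_gt (Num.max 0 (M + A))%R.
  have : ((Num.truncn (Num.max 0 (M + A))).+1%:R <= m%:R :> R)%R by rewrite ler_nat.
  have : (M + A <= Num.max 0 (M + A))%R by rewrite le_max lexx orbT.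
  have := hy m; lra.
(* Two subsets of [0, 2 A] of measure above (3/2) A, one of them translated by u_n <= A, both lie in
   [0, 3 A] and so cannot be disjoint. *)
pose I := `[0%R, (2 * A)%R]%classic : set R.
pose V (y : nat -> R) n := I `&` [set v | forall m, (n <= m)%N -> good (y m) v].
have mV y n : measurable (V y n).
  apply: measurableI; first exact: measurable_itv.
  have -> : [set v | forall m, (n <= m)%N -> good (y m) v] =
      \bigcap_(m in [set m | (n <= m)%N]) ((fun v => r (y m - v)%R) @^-1`
        `[((1 - d) * r (y m))%R, ((1 + d) * r (y m))%R]%classic).
    by apply/seteqP; split => v /= h m nm; have := h m nm; rewrite /= in_itv.
  apply: bigcap_measurable; first by exists n => /=.
  move=> m _; rewrite -[X in measurable X]setTI.
  apply: (measurableT_comp mr (measurable_subl (y m))) => //.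
have cV y : (forall n, n%:R - A <= y n)%R -> mu (V y n) @[n --> \oo] --> (2 * A)%:E.
  move=> hy; have -> : (2 * A)%:E = mu (\bigcup_n V y n).
    have -> : \bigcup_n V y n = I.
      apply/seteqP; split => [v [n _ []]//|v Iv].
      by have [n hn] := cvg_good y v hy; exists n.
    by rewrite /I lebesgue_measure_itv/= lte_fin mulr_gt0// oppr0 adde0.
  apply: nondecreasing_cvg_mu => [k||]; [exact: mV|by apply: bigcup_measurable => k _; exact: mV|].
  move=> m n mn; apply/subsetPset => v [Iv hv]; split=> // k nk.
  by apply: hv; exact: leq_trans nk.
have hx n : (n%:R - A <= x n)%R by have [h _ _] := Hxu n; rewrite /x; lra.
have hxu n : (n%:R - A <= x n - u n)%R.
  by have [h /andP[u0 uA] _] := Hxu n; rewrite /x /u; lra.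
have big y : (forall n, n%:R - A <= y n)%R ->
    \forall n \near \oo, (3 / 2 * A)%:E < mu (V y n).
  move=> hy; apply: (cV y hy [set z | (3 / 2 * A)%:E < z]).
  by apply: open_ereal_gt'; rewrite lte_fin; lra.
have [n [V1 V2]] : exists n, (3 / 2 * A)%:E < mu (V x n) /\
    (3 / 2 * A)%:E < mu (V (fun n => x n - u n)%R n).
  near \oo => n; exists n; split; near: n; exact: big.
have [n_x /andP[u0 uA] /negP bad] := Hxu n.
pose W := [set z | V (fun n => x n - u n)%R n (z - u n)%R].
have mW : measurable W.
  rewrite -[X in measurable X]setTI.
  have m1 : measurable_fun [set: R] (fun z => z - u n : R)%R by exact: measurable_funB.
  exact: (m1 measurableT _ (mV _ n)).
have muW : mu W = mu (V (fun n => x n - u n)%R n) by exact: lebesgue_measure_addr.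
have [v [Vv Wv]] : exists v, V x n v /\ W v.
  apply: contrapT => /forallNP nVW.
  have : mu (V x n `|` W) <= mu `[0%R, (3 * A)%R]%classic.
    apply: (@le_measure _ _ _ mu); rewrite ?inE//; first by apply: (measurableU _ _ (mV _ _) mW).
    move=> z [[]|[]]; rewrite /I /= !in_itv/= => /andP[? ?] _; rewrite -/(u n) in u0 uA; lra.
  have -> : mu (V x n `|` W) = mu (V x n) + mu W.
    apply: (measureU mu (mV _ _) mW); apply/seteqP; split => z //= [h1 h2].
    by case: (nVW z).
  rewrite muW lebesgue_measure_itv/= lte_fin mulr_gt0// oppr0 adde0 leNgt.
  move=> /negP; apply.
  by rewrite (_ : 3 * A = 3 / 2 * A + 3 / 2 * A)%R; [rewrite EFinD lteD|lra].
case: Vv Wv => _ /(_ n (leqnn n)) /andP[g1 g2] [_ /(_ n (leqnn n)) /andP[g3 g4]].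
apply: bad; rewrite -/(x n) -/(u n).
(* r (x_n) and r (x_n - u_n) are both compared with the single value r (x_n - v). *)
have E : (x n - u n - (v - u n) = x n - v)%R by lra.
rewrite E in g3 g4.
have rx := r0 (x n); have rxu := r0 (x n - u n)%R.
have ed : (e = 4 * d)%R by rewrite /d; lra.
rewrite ed in e_le1 *.
apply/andP; split.
  have h : ((1 - d) * r (x n) <= (1 + d) * r (x n - u n))%R by lra.
  rewrite -(ler_pM2l (_ : 0 < 1 + d)%R); last lra.
  apply: le_trans h; nra.
have h : ((1 - d) * r (x n - u n) <= (1 + d) * r (x n))%R by lra.
rewrite -(ler_pM2l (_ : 0 < 1 - d)%R); last lra.
apply: le_trans h _; nra.
Unshelve. all: by end_near. Qed.

End uniform_convergence.

(** * Asymptotic comparison of extended-valued functions *)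

Section asymptotics.
Context {R : realType}.
Implicit Types f g h : R -> \bar R.

Definition eventually_pos f := \forall x \near +oo%R, 0 < f x < +oo.

(** f / g tends to c, in a form without division, which combines directly with inequalities between
    integrals. *)
Definition sim (c : R) f g := forall e : R, (0 < e)%R ->
  \forall x \near +oo%R, (c - e)%:E * g x <= f x <= (c + e)%:E * g x.

(** Only shifts to the left are required, since these occur in a convolution on the half-line;
    shifts to the right follow by inverting the comparison. *)
Definition uniformly_long_tailed f := eventually_pos f /\
  forall A e : R, (0 < e)%R -> \forall x \near +oo%R, forall u : R,
    (0 <= u <= A)%R -> (1 - e)%:E * f x <= f (x - u)%R <= (1 + e)%:E * f x.

Lemma near_pinfty_addr (P : R -> Prop) (a : R) :
  (\forall x \near +oo%R, P x) -> \forall x \near +oo%R, P (x + a)%R.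
Proof.
move=> [M [_ HM]]; exists (M - a)%R; split; first exact: num_real.
by move=> x Mx; apply: HM; lra.
Qed.

Lemma fin_between (y : \bar R) (a b : R) : a%:E <= y -> y <= b%:E ->
  exists r : R, y = r%:E.
Proof. by case: y => [r _ _||]; [exists r|rewrite leye_eq|]. Qed.

Lemma fin_pos (y : \bar R) : 0 < y < +oo -> exists2 r : R, (0 < r)%R & y = r%:E.
Proof. by case: y => [r|/andP[]|/andP[]]//; rewrite lte_fin => /andP[? _]; exists r. Qed.

Lemma near_finE c f g : eventually_pos g -> sim c f g ->
  \forall x \near +oo%R, exists a b : R, [/\ f x = a%:E, g x = b%:E & (0 < b)%R].
Proof.
move=> g0 fg; near=> x.
have [b b0 gE] : exists2 b : R, (0 < b)%R & g x = b%:E by apply: fin_pos; near: x.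
have /andP[h1 h2] : (c - 1)%:E * g x <= f x <= (c + 1)%:E * g x.
  by near: x; exact: fg.
rewrite gE -!EFinM in h1 h2.
by have [a fE] := fin_between h1 h2; exists a, b.
Unshelve. all: by end_near. Qed.

Lemma sim_eventually_pos c f g : (0 < c)%R -> eventually_pos g -> sim c f g ->
  eventually_pos f.
Proof.
move=> c0 g0 fg; have c20 : (0 < c / 2)%R by lra.
near=> x.
have [a [b [fE gE b0]]] : exists a b : R, [/\ f x = a%:E, g x = b%:E & (0 < b)%R].
  by near: x; exact: (near_finE g0 fg).
have /andP[+ _] : (c - c / 2)%:E * g x <= f x <= (c + c / 2)%:E * g x.
  by near: x; exact: fg.
rewrite fE gE ltry andbT lte_fin -EFinM lee_fin; nra.
Unshelve. all: by end_near. Qed.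

Lemma simV c f g : (0 < c)%R -> eventually_pos g -> sim c f g -> sim c^-1 g f.
Proof.
move=> c0 g0 fg e e0.
(* d <= c / 2 gives f >= (c / 2) g, so the error (d / c) g <= (e c / 2) g is at most e f. *)
pose d := (Num.min (c / 2) (e * c ^+ 2 / 2))%R.
have d0 : (0 < d)%R.
  by rewrite lt_min !divr_gt0 ?mulr_gt0 ?exprn_gt0.
near=> x.
have [a [b [fE gE b0]]] : exists a b : R, [/\ f x = a%:E, g x = b%:E & (0 < b)%R].
  by near: x; exact: (near_finE g0 fg).
have : (c - d)%:E * g x <= f x <= (c + d)%:E * g x by near: x; exact: fg.
rewrite fE gE -!EFinM !lee_fin => /andP[h1 h2].
have dc : (d <= c / 2)%R by rewrite ge_min lexx.
have de : (d <= e * c ^+ 2 / 2)%R by rewrite ge_min lexx orbT.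
have a0 : (0 < a)%R by nra.
have iE : (c^-1 * a - b = c^-1 * (a - c * b))%R by field; rewrite gt_eqF.
have i0 : (0 < c^-1)%R by rewrite invr_gt0.
have k : (c^-1 * (d * b) <= e * a)%R.
  rewrite mulrC ler_pdivrMr//.
  have : (d * b <= e * c ^+ 2 / 2 * b)%R by rewrite ler_wpM2r// ltW.
  have : (e * c * (c / 2 * b) <= e * c * a)%R by rewrite ler_wpM2l ?mulr_ge0 ?(ltW e0) ?(ltW c0)//; nra.
  rewrite expr2; lra.
have k2 : (`|c^-1 * (a - c * b)| <= c^-1 * (d * b))%R.
  rewrite normrM gtr0_norm// ler_pM2l// ler_norml; apply/andP; split; lra.
move: (le_trans k2 k); rewrite ler_norml => /andP[? ?].
apply/andP; split; lra.
Unshelve. all: by end_near. Qed.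

Lemma sim_trans c c' f g h : (0 < c)%R -> (0 < c')%R -> eventually_pos h ->
  sim c f g -> sim c' g h -> sim (c * c')%R f h.
Proof.
move=> c0 c'0 h0 fg gh e e0.
pose d := (Num.min 1 (Num.min c (e / (c + c' + 1))))%R.
have s0 : (0 < c + c' + 1)%R by lra.
have d0 : (0 < d)%R by rewrite !lt_min ltr01 c0 divr_gt0.
have g0 := sim_eventually_pos c'0 h0 gh.
near=> x.
have [b [k [gE hE k0]]] : exists a b : R, [/\ g x = a%:E, h x = b%:E & (0 < b)%R].
  by near: x; exact: (near_finE h0 gh).
have [a [b' [fE gE' b0]]] : exists a b : R, [/\ f x = a%:E, g x = b%:E & (0 < b)%R].
  by near: x; exact: (near_finE g0 fg).
move: gE'; rewrite gE => -[bE]; rewrite -bE in b0 => {b' bE}.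
have : (c - d)%:E * g x <= f x <= (c + d)%:E * g x by near: x; exact: fg.
have : (c' - d)%:E * h x <= g x <= (c' + d)%:E * h x by near: x; exact: gh.
rewrite fE gE hE -!EFinM !lee_fin => /andP[h1 h2] /andP[h3 h4].
have d1 : (d <= 1)%R by rewrite ge_min lexx.
have dc : (d <= c)%R by rewrite !ge_min lexx orbT.
have de : (d * (c + c' + 1) <= e)%R by rewrite -ler_pdivlMr// !ge_min lexx !orbT.
have t1 : ((c - d) * ((c' - d) * k) <= a)%R.
  by apply: le_trans h3; rewrite ler_wpM2l// subr_ge0.
have t2 : (a <= (c + d) * ((c' + d) * k))%R.
  by apply: le_trans h4 _; rewrite ler_wpM2l// addr_ge0 ?ltW.
have t3 : (d * d <= d)%R by nra.
have t4 : (0 <= d * d)%R by rewrite mulr_ge0 ?ltW.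
apply/andP; split.
  apply: le_trans t1; rewrite mulrA ler_wpM2r ?(ltW k0)//; lra.
apply: le_trans t2 _; rewrite mulrA ler_wpM2r ?(ltW k0)//; lra.
Unshelve. all: by end_near. Qed.

Lemma sim_uniq c c' f g : eventually_pos g -> sim c f g -> sim c' f g -> c = c'.
Proof.
suff H : forall c c', eventually_pos g -> sim c f g -> sim c' f g -> (c <= c')%R.
  by move=> g0 h1 h2; apply/le_anti; rewrite (H c c')// (H c' c).
move=> {}c {}c' g0 h1 h2; rewrite leNgt; apply/negP => cc.
have d0 : (0 < (c - c') / 3)%R by lra.
near (pinfty_nbhs R) => x.
have [a [b [fE gE b0]]] : exists a b : R, [/\ f x = a%:E, g x = b%:E & (0 < b)%R].
  by near: x; exact: (near_finE g0 h1).
have : (c - (c - c') / 3)%:E * g x <= f x <= (c + (c - c') / 3)%:E * g x by near: x; exact: h1.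
have : (c' - (c - c') / 3)%:E * g x <= f x <= (c' + (c - c') / 3)%:E * g x by near: x; exact: h2.
rewrite fE gE -!EFinM !lee_fin => /andP[_ k1] /andP[k2 _].
have := le_trans k2 k1; rewrite ler_pM2r//; lra.
Unshelve. all: by end_near. Qed.

Lemma asymp_equiv_simP (a b : R) f g : (0 < a)%R -> (0 < b)%R ->
  asymp_equiv (fun x => a%:E * f x) (fun x => b%:E * g x) <->
  [/\ eventually_pos f, eventually_pos g & sim (b / a)%R f g].
Proof.
move=> a0 b0; split.
  move=> [fg0 /fine_cvgP[ffin fcvg]].
  have fpos : \forall x \near +oo%R, exists r s : R,
      [/\ (0 < r)%R, (0 < s)%R, f x = r%:E & g x = s%:E].
    near=> x.
    have [fx gx] : 0 < a%:E * f x /\ 0 < b%:E * g x by near: x.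
    have f0 : 0 < f x by rewrite -(pmule_rgt0 _ (_ : 0 < a%:E)).
    have g0 : 0 < g x by rewrite -(pmule_rgt0 _ (_ : 0 < b%:E)).
    have fin : a%:E * f x / (b%:E * g x) \is a fin_num by near: x.
    have r0 : (0 < fine (a%:E * f x / (b%:E * g x)))%R.
      by near: x; apply: (cvgr_gt 1%R).
    (* An infinite value of [f x] or [g x] makes the quotient 0 or [+oo], contrary to its being
       positive and finite. *)
    move: f0 g0 fin r0; case: (f x) => [r| |]//; case: (g x) => [s| |]//.
    - by rewrite !lte_fin => r0 s0 _ _; exists r, s.
    - by rewrite gt0_muley ?lte_fin// invey mule0 ltxx.
    - move=> _ s0; rewrite gt0_muley ?lte_fin// -EFinM inver.
      rewrite gt_eqF ?mulr_gt0//.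
      by rewrite gt0_mulye// lte_fin invr_gt0 mulr_gt0.
    - by rewrite !gt0_muley ?lte_fin// invey mule0 ltxx.
  split.
  - near=> x; have [r [s [r0 s0 -> _]]] : exists r s : R,
      [/\ (0 < r)%R, (0 < s)%R, f x = r%:E & g x = s%:E] by near: x.
    by rewrite lte_fin r0 ltry.
  - near=> x; have [r [s [r0 s0 _ ->]]] : exists r s : R,
      [/\ (0 < r)%R, (0 < s)%R, f x = r%:E & g x = s%:E] by near: x.
    by rewrite lte_fin s0 ltry.
  - move=> e e0; have e'0 : (0 < e * a / b)%R by rewrite divr_gt0 ?mulr_gt0.
    near=> x; have [r [s [r0 s0 fE gE]]] : exists r s : R,
      [/\ (0 < r)%R, (0 < s)%R, f x = r%:E & g x = s%:E] by near: x.
    have : (`|1 - fine (a%:E * f x / (b%:E * g x))| <= e * a / b)%R.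
      by near: x; move/cvgrPdist_le : fcvg => /(_ _ e'0).
    rewrite fE gE -!EFinM inver gt_eqF ?mulr_gt0//= ler_norml => /andP[h1 h2].
    rewrite !lee_fin.
    have k : (0 < b * s / a)%R by rewrite !mulr_gt0 ?invr_gt0.
    have E1 : ((1 - a * r * (b * s)^-1) * (b * s / a) = (b / a) * s - r)%R.
      by field; rewrite !gt_eqF.
    have E2 : (e * a / b * (b * s / a) = e * s)%R by field; rewrite !gt_eqF.
    have := ler_wpM2r (ltW k) h1; have := ler_wpM2r (ltW k) h2.
    rewrite mulNr E1 E2 => k1 k2; apply/andP; split; lra.
move=> [f0 g0 fg]; split.
  near=> x; have /andP[fx _] : 0 < f x < +oo by near: x.
  have /andP[gx _] : 0 < g x < +oo by near: x.
  by rewrite !mule_gt0 ?lte_fin.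
have fg' : \forall x \near +oo%R, exists r s : R,
    [/\ (0 < r)%R, (0 < s)%R, f x = r%:E & g x = s%:E].
  near=> x; have /fin_pos[r r0 ->] : 0 < f x < +oo by near: x.
  have /fin_pos[s s0 ->] : 0 < g x < +oo by near: x.
  by exists r, s.
apply/fine_cvgP; split.
  near=> x; have [r [s [r0 s0 -> ->]]] : exists r s : R,
      [/\ (0 < r)%R, (0 < s)%R, f x = r%:E & g x = s%:E] by near: x.
  by rewrite -!EFinM inver gt_eqF ?mulr_gt0// -EFinM.
apply/cvgrPdist_le => e e0 /=.
have e'0 : (0 < e * b / a)%R by rewrite divr_gt0 ?mulr_gt0.
near=> x; have [r [s [r0 s0 fE gE]]] : exists r s : R,
    [/\ (0 < r)%R, (0 < s)%R, f x = r%:E & g x = s%:E] by near: x.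
have : ((b / a) - e * b / a)%:E * g x <= f x <= ((b / a) + e * b / a)%:E * g x.
  by near: x; exact: fg.
rewrite fE gE -!EFinM inver gt_eqF ?mulr_gt0//= !lee_fin => /andP[h1 h2].
have k : (0 < a / (b * s))%R by rewrite divr_gt0 ?mulr_gt0.
have := ler_wpM2r (ltW k) h1; have := ler_wpM2r (ltW k) h2.
rewrite ler_norml.
have -> : (r * (a / (b * s)) = a * r * (b * s)^-1)%R by ring.
have -> : ((b / a + e * b / a) * s * (a / (b * s)) = 1 + e)%R.
  by field; rewrite !gt_eqF.
have -> : ((b / a - e * b / a) * s * (a / (b * s)) = 1 - e)%R.
  by field; rewrite !gt_eqF.
move=> k1 k2; apply/andP; split; lra.
Unshelve. all: by end_near. Qed.

End asymptotics.

(** * Long-tailed functions and their convolution with integrable functions *)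

Section long_tailed.
Context {R : realType}.
Local Notation mu := (@lebesgue_measure R).
Implicit Types f g h q : R -> \bar R.

Lemma near_pinfty_subr (P : R -> Prop) (A : R) : (\forall x \near +oo%R, P x) ->
  \forall x \near +oo%R, forall u, (u <= A)%R -> P (x - u)%R.
Proof.
move=> [M [_ HM]]; exists (M + A)%R; split; first exact: num_real.
by move=> x Mx u uA; apply: HM; lra.
Qed.

Lemma near_pinfty_gt (A : R) : \forall x \near +oo%R, (A < x)%R.
Proof. exact: nbhs_pinfty_gt (num_real A). Qed.

Lemma asymp_equivP f g : asymp_equiv f g <->
  [/\ eventually_pos f, eventually_pos g & sim 1 f g].
Proof.
have := @asymp_equiv_simP R 1 1 f g ltr01 ltr01.
have Z (h : R -> \bar R) : (fun x => 1%:E * h x) = h by apply/funext => x; rewrite mul1e.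
by rewrite (Z f) (Z g) divr1.
Qed.

Lemma uniform_of_long_tailed f : long_tailed f -> uniformly_long_tailed f.
Proof.
move=> [[f0 mf] lf].
have [_ fpos _] := (asymp_equivP _ _).1 (lf 0%R).
split=> // A e e0.
pose r x := fine (f x).
have fE x : f x = (r x)%:E.
  by rewrite fineK// ge0_fin_numE; have /andP[? ?] := f0 x.
have r0 x : (0 <= r x)%R by rewrite -lee_fin -fE; have /andP[] := f0 x.
have mr : measurable_fun [set: R] r by exact: (measurableT_comp _ mf).
have rl : forall u d : R, (0 < d)%R ->
   \forall x \near +oo%R, ((1 - d) * r x <= r (x - u) <= (1 + d) * r x)%R.
  move=> u d d0; have [_ _ /(_ d d0)] := (asymp_equivP _ _).1 (lf (- u)%R).
  by apply: filterS => x; rewrite !fE -!EFinM !lee_fin.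
have := uniform_long_tailed mr r0 rl A e0; apply: filterS => x H u /H.
by rewrite !fE -!EFinM !lee_fin.
Qed.

Lemma long_tailed_of_uniform f : nonneg_measurable f ->
  uniformly_long_tailed f -> long_tailed f.
Proof.
move=> f0 [fpos fu]; split=> // a; apply/asymp_equivP.
have fapos : eventually_pos (fun x => f (x + a)%R) by exact: (near_pinfty_addr a fpos).
split=> //.
have [a0|a0] := leP a 0%R.
  move=> e e0; have := fu (- a)%R e e0; apply: filterS => x /(_ (- a)%R).
  by rewrite opprK lexx oppr_ge0 a0; exact.
rewrite -invr1; apply: simV => //.
move=> e e0; have := near_pinfty_addr a (fu a e e0); apply: filterS => x /(_ a).
by rewrite addrK lexx (ltW a0); exact.
Qed.

Lemma uniformly_long_tailed_sim c f g : (0 < c)%R ->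
  uniformly_long_tailed g -> sim c f g -> uniformly_long_tailed f.
Proof.
move=> c0 [gpos gu] fg; split; first exact: (sim_eventually_pos c0 gpos fg).
(* Chosen so that (c + d)(1 + d) <= (1 + e)(c - d). *)
move=> A e e0; pose d := (Num.min 1 (Num.min c (e * c / (3 + c + e))))%R.
have s0 : (0 < 3 + c + e)%R by lra.
have d0 : (0 < d)%R by rewrite !lt_min ltr01 c0 divr_gt0 ?mulr_gt0.
have d1 : (d <= 1)%R by rewrite ge_min lexx.
have dc : (d <= c)%R by rewrite !ge_min lexx orbT.
have de : (d * (3 + c + e) <= e * c)%R by rewrite -ler_pdivlMr// !ge_min lexx !orbT.
move: d => d in d0 d1 dc de *.
near=> x => u uA.
have [a' [b [fE gE b0]]] : exists a b : R, [/\ f x = a%:E, g x = b%:E & (0 < b)%R].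
  by near: x; exact: (near_finE gpos fg).
have U : forall u, (u <= A)%R -> exists a b : R,
    [/\ f (x - u)%R = a%:E, g (x - u)%R = b%:E & (0 < b)%R].
  by near: x; exact: (near_pinfty_subr A (near_finE gpos fg)).
have W : forall u, (u <= A)%R ->
    (c - d)%:E * g (x - u)%R <= f (x - u)%R <= (c + d)%:E * g (x - u)%R.
  by near: x; exact: (near_pinfty_subr A (fg d d0)).
have V : forall u, (0 <= u <= A)%R ->
    (1 - d)%:E * g x <= g (x - u)%R <= (1 + d)%:E * g x by near: x; exact: gu.
have W0 : (c - d)%:E * g x <= f x <= (c + d)%:E * g x by near: x; exact: fg.
have /andP[u0 ua] := uA.
have [a2 [b2 [fE2 gE2 b20]]] := U u ua.
move: (W u ua) (V u uA) W0; rewrite fE2 gE2 fE gE -!EFinM !lee_fin.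
move=> /andP[h1 h2] /andP[h3 h4] /andP[h5 h6].
clear -h1 h2 h3 h4 h5 h6 d0 d1 dc de c0 e0 b0 b20.
have dd : (0 <= d * d)%R by rewrite mulr_ge0 ?ltW.
have dd1 : (d * d <= d)%R by nra.
have ed : (0 <= e * d)%R by rewrite mulr_ge0 ?ltW.
have k1 : ((c - d) * ((1 - d) * b) <= a2)%R.
  by apply: le_trans h1; rewrite ler_wpM2l// subr_ge0.
have k2 : (a2 <= (c + d) * ((1 + d) * b))%R.
  by apply: le_trans h2 _; rewrite ler_wpM2l// addr_ge0 ?ltW.
have j2 : ((c + d) * (1 + d) * b <= (1 + e) * (c - d) * b)%R.
  by rewrite ler_wpM2r ?(ltW b0)//; lra.
have j2' : ((1 + e) * ((c - d) * b) <= (1 + e) * a')%R by rewrite ler_wpM2l//; lra.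
apply/andP; split; last lra.
have [e1|e1] := leP e 1%R.
  have j1 : ((1 - e) * (c + d) * b <= (c - d) * (1 - d) * b)%R.
    by rewrite ler_wpM2r ?(ltW b0)//; lra.
  have j1' : ((1 - e) * a' <= (1 - e) * ((c + d) * b))%R by rewrite ler_wpM2l//; lra.
  lra.
have a'0 : (0 <= a')%R by apply: le_trans h5; rewrite mulr_ge0 ?subr_ge0// ltW.
apply: (@le_trans _ _ 0%R); first by rewrite mulr_le0_ge0//; lra.
by apply: le_trans k1; rewrite !mulr_ge0 ?subr_ge0// ltW.
Unshelve. all: by end_near. Qed.

Lemma xmulE f x : (0 <= x)%R -> xmul f x = x%:E * f x.
Proof. by move=> x0; rewrite /xmul max_l. Qed.

(** The additional factor (x - u) / x lies between 1 - A / x and 1, hence between 1 - d and 1 once x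
    > A / d. *)
Lemma uniformly_long_tailed_xmul f : uniformly_long_tailed f ->
  uniformly_long_tailed (xmul f).
Proof.
move=> [fpos fu]; split.
  near=> x; have x0 : (0 < x)%R by near: x; exact: near_pinfty_gt.
  have /fin_pos[r r0 fE] : 0 < f x < +oo by near: x.
  by rewrite xmulE ?ltW// fE -EFinM lte_fin mulr_gt0// ltry.
move=> A e e0; pose d := (Num.min e 1 / 2)%R.
have d0 : (0 < d)%R by rewrite divr_gt0// lt_min e0 ltr01.
have de : (2 * d <= e)%R by rewrite mulrC divfK// ge_min lexx.
have d1 : (2 * d <= 1)%R by rewrite mulrC divfK// ge_min lexx orbT.
move: d => d in d0 d1 de *.
near=> x => u /[dup] uA /andP[u0 ua].
have x0 : (0 < x)%R by near: x; exact: near_pinfty_gt.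
have Ax : (A < x)%R by near: x; exact: near_pinfty_gt.
have Adx : (A / d < x)%R by near: x; exact: near_pinfty_gt.
have /fin_pos[r r0 fE] : 0 < f x < +oo by near: x.
have V : forall u, (0 <= u <= A)%R ->
    (1 - d)%:E * f x <= f (x - u)%R <= (1 + d)%:E * f x by near: x; exact: fu.
have /andP[h1 h2] := V u uA; rewrite fE -!EFinM in h1 h2.
have [a fE2] := fin_between h1 h2; rewrite fE2 !lee_fin in h1 h2.
rewrite !xmulE; [|lra|lra]; rewrite fE fE2 -!EFinM !lee_fin.
rewrite ltr_pdivrMr// in Adx.
have a0 : (0 <= a)%R by apply: le_trans h1; rewrite mulr_ge0//; lra.
apply/andP; split.
  have j1 : ((x - u) * ((1 - d) * r) <= (x - u) * a)%R by rewrite ler_wpM2l//; lra.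
  apply: le_trans j1.
  have j2 : ((1 - e) * x * r <= (x - u) * (1 - d) * r)%R.
    rewrite ler_wpM2r ?(ltW r0)//.
    have du : (0 <= d * u)%R by rewrite mulr_ge0// ltW.
    have ex : (2 * d * x <= e * x)%R by rewrite ler_wpM2r// ltW.
    lra.
  lra.
clear -h2 a0 d0 de x0 u0 r0.
have j1 : ((x - u) * a <= x * a)%R by rewrite ler_wpM2r//; lra.
have j2 : (x * a <= x * ((1 + d) * r))%R by rewrite ler_wpM2l// ltW.
have j3 : (d * (x * r) <= e * (x * r))%R by rewrite ler_wpM2r ?mulr_ge0 ?ltW//; lra.
lra.
Unshelve. all: by end_near. Qed.

Definition low (A : R) f := fun x => if (x < A)%R then f x else 0.
Definition high (A : R) f := fun x => if (x < A)%R then 0 else f x.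

Lemma low_high A f x : f x = low A f x + high A f x.
Proof. by rewrite /low /high; case: ifP => _; rewrite ?adde0 ?add0e. Qed.

Lemma half_line_low A f : half_line f -> half_line (low A f).
Proof.
move=> [[f0 mf] fn]; split; last by move=> x x0; rewrite /low fn//; case: ifP.
split=> [x|]; first by rewrite /low; case: ifP.
apply: measurable_fun_ifT => //; exact: measurable_fun_ltr.
Qed.

Lemma half_line_high A f : half_line f -> half_line (high A f).
Proof.
move=> [[f0 mf] fn]; split; last by move=> x x0; rewrite /high fn//; case: ifP.
split=> [x|]; first by rewrite /high; case: ifP.
apply: measurable_fun_ifT => //; exact: measurable_fun_ltr.
Qed.

Lemma low_le A f x : half_line f -> low A f x <= f x.
Proof. by move=> hf; rewrite /low; case: ifP => // _; exact: hf.1.1. Qed.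

Lemma high_le A f x : half_line f -> high A f x <= f x.
Proof. by move=> hf; rewrite /high; case: ifP => // _; exact: hf.1.1. Qed.

Lemma integral_low f (m : R) : half_line f -> \int[mu]_x f x = m%:E ->
  forall A, exists2 l : R, \int[mu]_x low A f x = l%:E & (0 <= l <= m)%R.
Proof.
move=> hf fm A; have hl := half_line_low A hf.
have h1 := nn_integral_ge0 hl.1.
have h2 : \int[mu]_x low A f x <= m%:E.
  by rewrite -fm; apply: nn_le_integral => [||x]; [exact: hl.1|exact: hf.1|exact: low_le].
have [l lE] := fin_between h1 h2; exists l => //.
by rewrite lE !lee_fin in h1 h2; rewrite h1.
Qed.

Lemma integral_low_ge f (m : R) : half_line f -> \int[mu]_x f x = m%:E ->
  forall e : R, (0 < e)%R -> \forall A \near +oo%R,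
    (m - e)%:E <= \int[mu]_x low A f x.
Proof.
move=> hf fm e e0.
have cv : \int[mu]_x low n%:R f x @[n --> \oo] --> \int[mu]_x f x.
  have -> : \int[mu]_x f x = \int[mu]_x limn (fun n => low n%:R f x).
    apply: eq_integral => x _; apply/esym/cvg_lim => //.
    apply: (@cvg_near_cst _ _ (f x)).
    near=> n; rewrite /low ifT//.
    near: n; exact: nbhs_infty_gtr.
  apply: cvg_monotone_convergence => //.
  - by move=> n; exact: (half_line_low _ hf).1.2.
  - by move=> n x _; exact: (half_line_low _ hf).1.1.
  - move=> x _ n k nk; rewrite /low; case: ifPn => [xn|_].
      by rewrite ifT// (lt_le_trans xn)// ler_nat.
    by case: ifP => // _; exact: hf.1.1.
rewrite fm in cv.
have [N _ HN] : \forall n \near \oo, (m - e)%:E < \int[mu]_x low n%:R f x.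
  by apply: (cv [set z | (m - e)%:E < z]); apply: open_ereal_gt'; rewrite lte_fin; lra.
exists N%:R; split; first exact: num_real.
move=> A NA; apply: (le_trans (ltW (HN N (leqnn N)))).
apply: nn_le_integral => [||x]; [exact: (half_line_low _ hf).1|exact: (half_line_low _ hf).1|].
rewrite /low; case: ifPn => [xn|_]; first by rewrite ifT// (lt_trans xn).
by case: ifP => // _; exact: hf.1.1.
Unshelve. all: by end_near. Qed.

(** On the support of [low A g] the shift u stays in [0, A], where q (x - u) is uniformly close to q
    x. *)
Lemma conv_low q g A (l : R) : nn_measurable q -> uniformly_long_tailed q ->
  half_line g -> \int[mu]_x low A g x = l%:E ->
  forall e : R, (0 < e <= 1)%R -> \forall x \near +oo%R,
    ((1 - e) * l)%:E * q x <= convolution q (low A g) x <= ((1 + e) * l)%:E * q x.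
Proof.
move=> mq [qpos qu] hg gl e /andP[e0 e1].
have hl := half_line_low A hg.
near=> x; have /fin_pos[b b0 qE] : 0 < q x < +oo by near: x.
have V : forall u, (0 <= u <= A)%R ->
    (1 - e)%:E * q x <= q (x - u)%R <= (1 + e)%:E * q x by near: x; exact: qu.
have c1 : (0 <= (1 - e) * b)%R by rewrite mulr_ge0 ?subr_ge0// ltW.
have c2 : (0 <= (1 + e) * b)%R by rewrite mulr_ge0 ?addr_ge0// ltW.
have mi := nn_measurable_conv_integrand x mq hl.1.
have E (c : R) : (c * l)%:E * q x = (c * b)%:E * \int[mu]_u low A g u.
  by rewrite gl qE -!EFinM; congr EFin; ring.
rewrite !E -!nn_integralZl//; [|exact: hl.1|exact: hl.1].
apply/andP; split; apply: nn_le_integral => //; try exact: (nn_measurableZ _ hl.1).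
- move=> u; rewrite {1 2}/low; case: ifP => [uA|_]; last by rewrite !mule0.
  have [u0|u0] := ltP u 0%R; first by rewrite hg.2// !mule0.
  rewrite lee_wpmul2r ?hg.1.1// EFinM -qE.
  by have /V/andP[] : (0 <= u <= A)%R by rewrite u0 ltW.
- move=> u; rewrite {1 2}/low; case: ifP => [uA|_]; last by rewrite !mule0.
  have [u0|u0] := ltP u 0%R; first by rewrite hg.2// !mule0.
  rewrite lee_wpmul2r ?hg.1.1// EFinM -qE.
  by have /V/andP[] : (0 <= u <= A)%R by rewrite u0 ltW.
Unshelve. all: by end_near. Qed.

(** For a lower bound the shifts beyond a large A may be dropped, at the cost of a small part of the
    mass of g; thus long-tailedness alone gives this half. *)
Lemma conv_ge q g (m : R) : nn_measurable q -> uniformly_long_tailed q ->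
  half_line g -> \int[mu]_x g x = m%:E ->
  forall e : R, (0 < e)%R -> \forall x \near +oo%R,
    (m - e)%:E * q x <= convolution q g x.
Proof.
move=> mq qu hg gm e e0.
have m0 : (0 <= m)%R by rewrite -lee_fin -gm; apply: nn_integral_ge0; exact: hg.1.
pose d := (Num.min 1 (e / (1 + m)))%R.
have s0 : (0 < 1 + m)%R by lra.
have d0 : (0 < d)%R by rewrite lt_min ltr01 divr_gt0.
have d1 : (d <= 1)%R by rewrite ge_min lexx.
have de : (d * (1 + m) <= e)%R by rewrite -ler_pdivlMr// ge_min lexx orbT.
move: d => d in d0 d1 de *.
near (pinfty_nbhs R) => A.
have mA : (m - d)%:E <= \int[mu]_x low A g x by near: A; exact: integral_low_ge.
have [l lE /andP[l0 lm]] := integral_low hg gm A.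
rewrite lE lee_fin in mA.
near=> x; have /fin_pos[b b0 qE] : 0 < q x < +oo by near: x; exact: qu.1.
apply: (@le_trans _ _ (convolution q (low A g) x)).
  have /andP[+ _] : ((1 - d) * l)%:E * q x <= convolution q (low A g) x <= ((1 + d) * l)%:E * q x.
    by near: x; apply: conv_low => //; rewrite d0.
  apply: le_trans; rewrite qE -!EFinM lee_fin ler_wpM2r ?(ltW b0)//.
  have : ((1 - d) * (m - d) <= (1 - d) * l)%R by rewrite ler_wpM2l// subr_ge0.
  have : (0 <= d * d)%R by rewrite mulr_ge0 ?ltW.
  lra.
apply: le_conv => // [||u]; [exact: (half_line_low _ hg).1|exact: hg.1|exact: low_le].
Unshelve. all: by end_near. Qed.

End long_tailed.

(** * Subexponentiality *)

Section subexponential.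
Context {R : realType}.
Local Notation mu := (@lebesgue_measure R).
Implicit Types f g h q : R -> \bar R.

(* For half-line densities, this is what subexponentiality adds to
   long-tailedness. *)
Definition negligible_middle f := forall e : R, (0 < e)%R -> exists A : R,
  \forall x \near +oo%R, convolution (high A f) (high A f) x <= e%:E * f x.

Lemma high_anti A B f x : half_line f -> (A <= B)%R -> high B f x <= high A f x.
Proof.
move=> hf AB; rewrite /high; case: ifPn => xB; case: ifPn => xA //; first exact: hf.1.1.
by move: xB; rewrite (lt_le_trans xA).
Qed.

Lemma negligible_middle_near f : half_line f -> negligible_middle f ->
  forall e : R, (0 < e)%R -> \forall A \near +oo%R, \forall x \near +oo%R,
    convolution (high A f) (high A f) x <= e%:E * f x.
Proof.
move=> hf fm e e0; have [A HA] := fm e e0.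
exists A; split; first exact: num_real.
move=> B AB; apply: filterS HA => x; apply: le_trans.
have hA := half_line_high A hf; have hB := half_line_high B hf.
by apply: le_conv => [||||y|y]; [exact: hB.1|exact: hB.1|exact: hA.1|exact: hA.1
  |exact: high_anti (ltW AB)|exact: high_anti (ltW AB)].
Qed.

Lemma le_high (C : R) f g : half_line g -> (0 <= C)%R ->
  (\forall x \near +oo%R, f x <= C%:E * g x) ->
  \forall A \near +oo%R, forall x, high A f x <= C%:E * high A g x.
Proof.
move=> hg C0 [M [_ HM]]; exists M; split; first exact: num_real.
move=> A MA x; rewrite /high; case: ifPn => [_|]; first by rewrite mule0.
by rewrite -leNgt => Ax; apply: HM; exact: lt_le_trans MA Ax.
Qed.

Lemma negligible_middle_sim c f g : (0 < c)%R -> half_line f -> half_line g ->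
  eventually_pos g -> sim c f g -> negligible_middle g -> negligible_middle f.
Proof.
move=> c0 hf hg gpos fg gm e e0.
have c20 : (0 < c / 2)%R by lra.
have cc0 : (0 <= 2 * c)%R by lra.
(* (2 c)^2 e / (8 c) = e c / 2: each factor is bounded by 2 c g, and f >= (c / 2) g. *)
have e'0 : (0 < e / (8 * c))%R by rewrite divr_gt0// mulr_gt0.
near (pinfty_nbhs R) => A.
have mA : \forall x \near +oo%R,
    convolution (high A g) (high A g) x <= (e / (8 * c))%:E * g x.
  by near: A; exact: negligible_middle_near.
have hA : forall x, high A f x <= (2 * c)%:E * high A g x.
  near: A; apply: le_high => //; have := fg c c0; apply: filterS => x /andP[_].
  by rewrite (_ : c + c = 2 * c)%R//; lra.
exists A; near=> x.
have [a [b [fE gE b0]]] : exists a b : R, [/\ f x = a%:E, g x = b%:E & (0 < b)%R].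
  by near: x; exact: (near_finE gpos fg).
have /andP[h1 _] : (c - c / 2)%:E * g x <= f x <= (c + c / 2)%:E * g x.
  by near: x; exact (fg _ c20).
have h2 : convolution (high A g) (high A g) x <= (e / (8 * c))%:E * g x by near: x.
have kf := half_line_high A hf; have kg := half_line_high A hg.
have kz := half_lineZ cc0 kg.
apply: (@le_trans _ _ (convolution (fun x => (2 * c)%:E * high A g x)
                         (fun x => (2 * c)%:E * high A g x) x)).
  by apply: le_conv => //; [exact: kf.1|exact: kf.1|exact: kz.1|exact: kz.1].
rewrite convZl//; [|exact: kg.1|exact: kz.1].
rewrite convZr//; [|exact: kg.1|exact: kg.1].
have := lee_wpmul2l (_ : 0 <= (2 * c * (2 * c))%:E) h2.
rewrite lee_fin mulr_ge0// => /(_ isT).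
rewrite !muleA -!EFinM => h3; apply: (le_trans h3).
rewrite gE fE -!EFinM !lee_fin in h1 *.
apply: (le_trans _ (ler_wpM2l (ltW e0) h1)).
rewrite le_eqVlt; apply/orP; left; apply/eqP.
by field; rewrite gt_eqF.
Unshelve. all: by end_near. Qed.

(** Below A, g contributes its mass by [conv_low]. Above A, g <= C q, and M q is split as well:
    where its argument is below A it is at most A q, which yields O(q) = o(M q) in all; where it is
    above A, the result is at most C M (high q * high q), small by negligibility of the middle. Each
    of the three parts gets e / 3. *)
Lemma conv_xmul_le q g (mq m C : R) : half_line q -> uniformly_long_tailed q ->
  negligible_middle q -> \int[mu]_x q x = mq%:E ->
  half_line g -> \int[mu]_x g x = m%:E ->
  (0 <= C)%R -> (\forall x \near +oo%R, g x <= C%:E * q x) ->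
  forall e : R, (0 < e)%R -> \forall x \near +oo%R,
    convolution (xmul q) g x <= (m + e)%:E * xmul q x.
Proof.
move=> hq qu qm qmq hg gm C0 gC e e0.
have m0 : (0 <= m)%R by rewrite -lee_fin -gm; apply: nn_integral_ge0; exact: hg.1.
have mq0 : (0 <= mq)%R by rewrite -lee_fin -qmq; apply: nn_integral_ge0; exact: hq.1.
have hxq := half_line_xmul hq.
have xqu := uniformly_long_tailed_xmul qu.
pose d := (Num.min 1 (e / (3 * (m + 1))))%R.
have d0 : (0 < d)%R by rewrite lt_min ltr01 divr_gt0// mulr_gt0// ltr_wpDl.
have d1 : (d <= 1)%R by rewrite ge_min lexx.
have de : (d * (3 * (m + 1)) <= e)%R.
  by rewrite -ler_pdivlMr ?ge_min ?lexx ?orbT// mulr_gt0// ltr_wpDl.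
move: d => d in d0 d1 de *.
pose e2 := (e / (3 * (C + 1)))%R.
have C10 : (0 < 3 * (C + 1))%R by rewrite mulr_gt0// ltr_wpDl.
have e20 : (0 < e2)%R by rewrite divr_gt0.
have Ce2 : (3 * (C * e2) <= e)%R.
  have : (e2 * (3 * (C + 1)) = e)%R by rewrite /e2 divfK// gt_eqF.
  lra.
move: e2 => e2 in e20 Ce2 *.
near (pinfty_nbhs R) => A.
have A0 : (0 < A)%R by near: A; exact: near_pinfty_gt.
have gA : forall x, high A g x <= C%:E * high A q x by near: A; exact: le_high.
have mA : \forall x \near +oo%R, convolution (high A q) (high A q) x <= e2%:E * q x.
  by near: A; exact: negligible_middle_near.
have [l lE /andP[l0 lm]] := integral_low hg gm A.
have [k kE /andP[k0 km]] := integral_low hq qmq A.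
have hgl := half_line_low A hg; have hgh := half_line_high A hg.
have hql := half_line_low A hq; have hqh := half_line_high A hq.
have hAl := half_lineZ (ltW A0) hql; have hx := half_line_xmul hqh.
have hCh := half_lineZ C0 hqh.
near=> x.
have x0 : (0 < x)%R by near: x; exact: near_pinfty_gt.
(* Beyond this threshold the term 2 C A mq q x is at most (e / 3) x q x. *)
have Cx : (C * A * 2 * mq / (e / 3) < x)%R by near: x; exact: near_pinfty_gt.
have /fin_pos[b b0 qE] : 0 < q x < +oo by near: x; exact: qu.1.
have xqE : xmul q x = (x * b)%:E by rewrite xmulE ?ltW// qE -EFinM.
have h1 : convolution (xmul q) (low A g) x <= ((1 + d) * l)%:E * xmul q x.
  have /andP[_] : ((1 - d) * l)%:E * xmul q x <= convolution (xmul q) (low A g) x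
      <= ((1 + d) * l)%:E * xmul q x.
    by near: x; apply: conv_low => //; [exact: hxq.1|rewrite d0].
  by [].
have h2 : convolution q (low A q) x <= ((1 + 1) * k)%:E * q x.
  have /andP[_] : ((1 - 1) * k)%:E * q x <= convolution q (low A q) x
      <= ((1 + 1) * k)%:E * q x.
    by near: x; apply: conv_low => //; [exact: hq.1|rewrite ltr01 lexx].
  by [].
have h3 : convolution (high A q) (high A q) x <= e2%:E * q x by near: x.
have h4 : convolution (xmul (high A q)) (high A q) x <= (x * (e2 * b))%:E.
  (* One of the two terms of the Leibniz rule is discarded. *)
  apply: (@le_trans _ _ (xmul (convolution (high A q) (high A q)) x)).
    rewrite xmul_conv// leeDl//; exact: (half_line_conv hqh hx).1.1.
  by rewrite xmulE ?(ltW x0)// EFinM lee_wpmul2l ?lee_fin ?(ltW x0)// EFinM -qE.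
have h5 : convolution (low A q) (high A q) x <= (2 * k * b)%:E.
  rewrite convC; [|exact: hql.1|exact: hqh.1].
  apply: (@le_trans _ _ (convolution q (low A q) x)).
    by apply: le_conv => // [||||y]; [exact: hqh.1|exact: hql.1|exact: hq.1
      |exact: hql.1|exact: high_le].
  by apply: le_trans h2 _; rewrite qE -EFinM lee_fin.
have h6 : convolution (xmul q) (high A g) x <= (C * (A * (2 * k * b) + x * (e2 * b)))%:E.
  apply: (@le_trans _ _ (convolution (fun x => A%:E * low A q x + xmul (high A q) x)
                           (fun x => C%:E * high A q x) x)).
    apply: le_conv => // [||||y].
    - exact: hxq.1.
    - exact: hgh.1.
    - exact: (half_lineD hAl hx).1.
    - exact: hCh.1.
    - rewrite /xmul /low /high; case: ifPn => [yA|_].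
        rewrite mule0 adde0 lee_wpmul2r ?hq.1.1// lee_fin ge_max (ltW yA)/=.
        exact: ltW.
      by rewrite mule0 add0e.
  rewrite convZr//; [|exact: (half_lineD hAl hx).1|exact: hqh.1].
  rewrite convDl; [|exact: hAl.1|exact: hx.1|exact: hqh.1].
  rewrite convZl ?(ltW A0)//; [|exact: hql.1|exact: hqh.1].
  rewrite EFinM lee_wpmul2l ?lee_fin// EFinD leeD//.
  by rewrite EFinM lee_wpmul2l ?lee_fin// ltW.
have -> : convolution (xmul q) g x =
    convolution (xmul q) (low A g) x + convolution (xmul q) (high A g) x.
  have gE : g = (fun y => low A g y + high A g y) by apply/funext => y; exact: low_high.
  by have := convDr hxq.1 hgl.1 hgh.1; rewrite -gE => ->.
apply: (le_trans (leeD h1 h6)).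
rewrite xqE -EFinM -EFinD lee_fin.
clear -d0 d1 de m0 mq0 C0 C10 e20 Ce2 A0 l0 lm k0 km x0 Cx b0 e0.
have xb : (0 < x * b)%R by rewrite mulr_gt0.
have j1 : ((1 + d) * l * (x * b) <= (m + e / 3) * (x * b))%R.
  rewrite ler_wpM2r ?(ltW xb)//.
  have : ((1 + d) * l <= (1 + d) * m)%R by rewrite ler_wpM2l//; lra.
  lra.
have j2 : (C * (x * (e2 * b)) <= e / 3 * (x * b))%R.
  have : (C * e2 * (x * b) <= e / 3 * (x * b))%R by rewrite ler_wpM2r ?(ltW xb)//; lra.
  lra.
have j3 : (C * (A * (2 * k * b)) <= e / 3 * (x * b))%R.
  rewrite ltr_pdivrMr in Cx; last by rewrite divr_gt0.
  have CA : (0 <= C * A * 2)%R by rewrite !mulr_ge0// ltW.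
  have : (C * A * 2 * k * b <= C * A * 2 * mq * b)%R.
    by rewrite ler_wpM2r ?(ltW b0)// ler_wpM2l.
  have : (C * A * 2 * mq * b <= x * (e / 3) * b)%R by rewrite ler_wpM2r ?ltW.
  lra.
lra.
Unshelve. all: by end_near. Qed.

(** For x >= 2 A the arguments u and x - u cannot both be below A; the two mixed terms agree by
    commutativity. *)
Lemma conv_split q A x : half_line q -> (2 * A <= x)%R -> convolution q q x =
  2%:E * convolution q (low A q) x + convolution (high A q) (high A q) x.
Proof.
move=> hq Ax; have hl := half_line_low A hq; have hh := half_line_high A hq.
have qE : q = (fun y => low A q y + high A q y) by apply/funext => y; exact: low_high.
have ll : convolution (low A q) (low A q) x = 0.
  apply: integral0_eq => u _; rewrite /low; case: ifPn => h1; last by rewrite mul0e.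
  case: ifPn => h2; last by rewrite mule0.
  exfalso; lra.
have ql : convolution q (low A q) x = convolution (high A q) (low A q) x.
  rewrite {1}qE convDl; [|exact: hl.1|exact: hh.1|exact: hl.1].
  by rewrite ll add0e.
have -> : convolution q q x = convolution q (low A q) x + convolution q (high A q) x.
  have := @convDr R q (low A q) (high A q) hq.1 hl.1 hh.1.
  by rewrite -qE => ->.
have -> : convolution q (high A q) x =
    convolution (high A q) (low A q) x + convolution (high A q) (high A q) x.
  rewrite {1}qE convDl; [|exact: hl.1|exact: hh.1|exact: hh.1].
  by congr (_ + _); rewrite convC//; [exact: hl.1|exact: hh.1].
rewrite -ql addeA; congr (_ + _).
have c0 := (half_line_conv hq hl).1.1 x.
by rewrite -{1 2}[convolution q _ x]mul1e -ge0_muleDl// -EFinD.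
Qed.

(** In [conv_split] the first term is close to 2 q for large A, by long-tailedness and unit mass. So
    q * q ~ 2 q holds exactly when the other term can be made a small multiple of q. *)
Lemma subexp_density_half_line q : half_line q -> is_density q ->
  subexp_density q <-> uniformly_long_tailed q /\ negligible_middle q.
Proof.
move=> hq qd; have q1 : \int[mu]_x q x = 1%:E by case: qd.
have as2 : asymp_equiv (conv_pow q 2) (fun x => 2%:E * q x) <->
    [/\ eventually_pos (convolution q q), eventually_pos q & sim 2 (convolution q q) q].
  have := @asymp_equiv_simP R 1 2 (convolution q q) q ltr01 (ltr0Sn _ 1).
  rewrite (_ : (fun x => 1%:E * convolution q q x) = conv_pow q 2) ?divr1//.
  by apply/funext => x; rewrite mul1e.
split.
  move=> [[_ ql] /as2[_ _ q2]]; have qu := uniform_of_long_tailed ql.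
  split=> // e e0; pose d := (Num.min 1 (e / 5))%R.
  have d0 : (0 < d)%R by rewrite lt_min ltr01 divr_gt0.
  have d1 : (d <= 1)%R by rewrite ge_min lexx.
  have de : (d * 5 <= e)%R by rewrite -ler_pdivlMr// ge_min lexx orbT.
  move: d => d in d0 d1 de *.
  near (pinfty_nbhs R) => A.
  have lA : (1 - d)%:E <= \int[mu]_x low A q x by near: A; exact: integral_low_ge.
  have [l lE /andP[l0 l1]] := integral_low hq q1 A.
  rewrite lE lee_fin in lA.
  exists A; near=> x.
  have Ax : (2 * A <= x)%R by apply: ltW; near: x; exact: near_pinfty_gt.
  have /fin_pos[b b0 qE] : 0 < q x < +oo by near: x; exact: qu.1.
  have /andP[_] : (2 - d)%:E * q x <= convolution q q x <= (2 + d)%:E * q x.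
    by near: x; exact: q2.
  have /andP[h1 h2] : ((1 - d) * l)%:E * q x <= convolution q (low A q) x <=
      ((1 + d) * l)%:E * q x.
    by near: x; apply: conv_low => //; [exact: hq.1|rewrite d0].
  rewrite (conv_split hq Ax) ?qE -?EFinM; rewrite qE -!EFinM in h1 h2 *.
  have [c cE] := fin_between h1 h2; rewrite cE !lee_fin -EFinM in h1 h2 *.
  have := (half_line_conv (half_line_high A hq) (half_line_high A hq)).1.1 x.
  case: (convolution (high A q) (high A q) x) => [h||]//.
  rewrite -EFinD !lee_fin => _ h3.
  have : ((1 - d) * (1 - d) * b <= (1 - d) * l * b)%R.
    by rewrite ler_wpM2r ?(ltW b0)// ler_wpM2l// subr_ge0.
  have : (0 <= d * d * b)%R by rewrite !mulr_ge0 ?ltW.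
  have : (d * 5 * b <= e * b)%R by rewrite ler_wpM2r ?(ltW b0).
  lra.
move=> [qu qm].
have q2 : sim 2 (convolution q q) q.
  move=> e e0; pose d := (Num.min 1 (e / 5))%R.
  have d0 : (0 < d)%R by rewrite lt_min ltr01 divr_gt0.
  have d1 : (d <= 1)%R by rewrite ge_min lexx.
  have de : (d * 5 <= e)%R by rewrite -ler_pdivlMr// ge_min lexx orbT.
  move: d => d in d0 d1 de *.
  near (pinfty_nbhs R) => A.
  have lA : (1 - d)%:E <= \int[mu]_x low A q x by near: A; exact: integral_low_ge.
  have mA : \forall x \near +oo%R, convolution (high A q) (high A q) x <= d%:E * q x.
    by near: A; exact: negligible_middle_near.
  have [l lE /andP[l0 l1]] := integral_low hq q1 A.
  rewrite lE lee_fin in lA.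
  near=> x.
  have Ax : (2 * A <= x)%R by apply: ltW; near: x; exact: near_pinfty_gt.
  have /fin_pos[b b0 qE] : 0 < q x < +oo by near: x; exact: qu.1.
  have /andP[h1 h2] : ((1 - d) * l)%:E * q x <= convolution q (low A q) x <=
      ((1 + d) * l)%:E * q x.
    by near: x; apply: conv_low => //; [exact: hq.1|rewrite d0].
  have h3 : convolution (high A q) (high A q) x <= d%:E * q x by near: x.
  rewrite (conv_split hq Ax) ?qE -?EFinM; rewrite qE -!EFinM in h1 h2 h3 *.
  have [c cE] := fin_between h1 h2; rewrite cE !lee_fin -EFinM in h1 h2 *.
  have k0 := (half_line_conv (half_line_high A hq) (half_line_high A hq)).1.1 x.
  have [k kE] := fin_between k0 h3.
  rewrite kE -?EFinD !lee_fin in k0 h3 *.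
  have : ((1 - d) * (1 - d) * b <= (1 - d) * l * b)%R.
    by rewrite ler_wpM2r ?(ltW b0)// ler_wpM2l// subr_ge0.
  have : ((1 + d) * l * b <= (1 + d) * 1 * b)%R.
    by rewrite ler_wpM2r ?(ltW b0)// ler_wpM2l// addr_ge0// ltW.
  have : (0 <= d * d * b)%R by rewrite !mulr_ge0 ?ltW.
  have : (d * 5 * b <= e * b)%R by rewrite ler_wpM2r ?(ltW b0).
  have : (0 <= d * b)%R by rewrite mulr_ge0 ?ltW.
  move=> *; apply/andP; split; lra.
split; first by split=> //; apply: long_tailed_of_uniform => //; case: qd.
apply/as2; split; [|exact: qu.1|exact: q2].
exact: (sim_eventually_pos _ qu.1 q2).
Unshelve. all: by end_near. Qed.

End subexponential.

(** * Convolution with x f(x) for subexponential f *)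

Section tail_equivalence.
Context {R : realType}.
Local Notation mu := (@lebesgue_measure R).
Implicit Types f g h q : R -> \bar R.

Lemma near_pinftyW (P : R -> Prop) : (forall x, P x) -> \forall x \near +oo%R, P x.
Proof. by move=> H; near=> x; exact: H.
Unshelve. all: by end_near. Qed.

Lemma sim_scale c f : (forall x, 0 <= f x) -> sim c (fun x => c%:E * f x) f.
Proof.
move=> f0 e e0; near=> x.
by apply/andP; split; apply: lee_wpmul2r => //; rewrite lee_fin; lra.
Unshelve. all: by end_near. Qed.

Lemma sim_xmul c f g : sim c (xmul f) (xmul g) -> sim c f g.
Proof.
move=> fg e e0; near=> x.
have x0 : (0 < x)%R by near: x; exact: near_pinfty_gt.
have : (c - e)%:E * xmul g x <= xmul f x <= (c + e)%:E * xmul g x.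
  by near: x; exact: fg.
by rewrite !xmulE ?(ltW x0)// !(muleCA _ x%:E) !lee_pmul2l.
Unshelve. all: by end_near. Qed.

(** Free of normalization, so that it applies directly to [cpois], whose mass is exp (lam t) - 1. *)
Definition subexp f := uniformly_long_tailed f /\ negligible_middle f.

Lemma subexp_sim c f g : (0 < c)%R -> half_line f -> half_line g ->
  sim c f g -> subexp g -> subexp f.
Proof.
move=> c0 hf hg fg [gu gm]; split; first exact: (uniformly_long_tailed_sim c0 gu fg).
exact: (negligible_middle_sim c0 hf hg gu.1 fg gm).
Qed.

Lemma conv_xmul_sim q g (mq m C : R) : half_line q -> subexp q ->
  \int[mu]_x q x = mq%:E -> half_line g -> \int[mu]_x g x = m%:E ->
  (0 <= C)%R -> (\forall x \near +oo%R, g x <= C%:E * q x) ->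
  sim m (convolution g (xmul q)) (xmul q).
Proof.
move=> hq [qu qm] qmq hg gm C0 gC e e0.
rewrite convC; [|exact: hg.1|exact: (half_line_xmul hq).1].
near=> x; apply/andP; split; near: x.
  apply: conv_ge => //; first exact: (half_line_xmul hq).1.
  exact: uniformly_long_tailed_xmul.
exact: conv_xmul_le qm qmq hg gm C0 gC e e0.
Unshelve. all: by end_near. Qed.

End tail_equivalence.

(** * Transfer of subexponentiality between different times *)

Section compound_poisson_subexponential.
Context {R : realType}.
Local Notation mu := (@lebesgue_measure R).
Variables (lam : R) (phi : R -> \bar R).
Hypothesis lam_gt0 : (0 < lam)%R.
Hypothesis hphi : half_line phi.
Hypothesis phi1 : \int[mu]_x phi x = 1.
Implicit Types s t d : R.

Local Notation q := (cpois lam phi).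
Let hq t := half_line_cpois lam_gt0 hphi (t := t).
Let int_q t := integral_cpois lam_gt0 hphi phi1 (t := t).

(** Both halves of the inverse are dominated by q_d <= q_(s+d), so [conv_xmul_sim] applies to each
    and their convolutions with M q_(s+d) are close to c and h times M q_(s+d). The resulting factor
    is 1 + c - h = exp (- lam d). *)
Lemma cpois_sim_down s d : (0 < s)%R -> (0 <= d)%R -> subexp (q (s + d)) ->
  sim (s / (s + d) * expR (- (lam * d)))%R (q s) (q (s + d)).
Proof.
move=> s0 d0 Q; have sd0 : (0 < s + d)%R by lra.
have hQ := hq (ltW sd0).
have [c [h [cE hE ch]]] := integral_cosh_sinh lam_gt0 hphi phi1 d0.
have hc := half_line_cpois_cosh lam_gt0 hphi d0.
have hs := half_line_cpois_sinh lam_gt0 hphi d0.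
have dom x : q d x <= 1%:E * q (s + d) x.
  by rewrite mul1e; apply: le_cpois => //; lra.
have ac := conv_xmul_sim hQ Q (int_q (ltW sd0)) hc cE ler01 (near_pinftyW (fun x =>
  le_trans (cpois_cosh_le lam_gt0 hphi x d0) (dom x))).
have as_ := conv_xmul_sim hQ Q (int_q (ltW sd0)) hs hE ler01 (near_pinftyW (fun x =>
  le_trans (cpois_sinh_le lam_gt0 hphi x d0) (dom x))).
have Xpos := (uniformly_long_tailed_xmul Q.1).1.
apply: sim_xmul => e e0.
have k0 : (0 < (s + d) / s)%R by rewrite divr_gt0.
pose a := (e * ((s + d) / s) / 2)%R.
have a0 : (0 < a)%R by rewrite /a divr_gt0// mulr_gt0.
near=> x.
have /fin_pos[b b0 XE] : 0 < xmul (q (s + d)) x < +oo by near: x.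
have /andP[h1 h2] : (c - a)%:E * xmul (q (s + d)) x <=
    convolution (cpois_cosh lam phi d) (xmul (q (s + d))) x <=
    (c + a)%:E * xmul (q (s + d)) x by near: x; exact: (ac a a0).
have /andP[h3 h4] : (h - a)%:E * xmul (q (s + d)) x <=
    convolution (cpois_sinh lam phi d) (xmul (q (s + d))) x <=
    (h + a)%:E * xmul (q (s + d)) x by near: x; exact: (as_ a a0).
have := xmul_cpois_inv lam_gt0 hphi x s0 d0.
rewrite XE -!EFinM in h1 h2 h3 h4 *.
have [cc ccE] := fin_between h1 h2; have [hh hhE] := fin_between h3 h4.
rewrite ccE hhE !lee_fin in h1 h2 h3 h4 *.
have := (half_line_xmul (hq (ltW s0))).1.1 x.
(* The identity itself excludes an infinite value, all its other terms being finite. *)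
case: (xmul (q s) x) => [y _|_|//]; last by rewrite gt0_muley ?lte_fin.
rewrite -EFinM -!EFinD => -[E].
have yE : (y = s / (s + d) * (b + cc - hh))%R.
  rewrite E; field; rewrite !gt_eqF//.
rewrite !lee_fin yE -ch.
have i0 : (0 < s / (s + d))%R by rewrite divr_gt0.
have aE : (s / (s + d) * (2 * a) = e)%R by rewrite /a; field; rewrite !gt_eqF.
have k1 : (s / (s + d) * ((1 + c - h - 2 * a) * b) <= s / (s + d) * (b + cc - hh))%R.
  by rewrite ler_wpM2l ?(ltW i0)//; lra.
have k2 : (s / (s + d) * (b + cc - hh) <= s / (s + d) * ((1 + c - h + 2 * a) * b))%R.
  by rewrite ler_wpM2l ?(ltW i0)//; lra.
have k3 : (s / (s + d) * (2 * a) * b = e * b)%R by rewrite aE.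
apply/andP; split; lra.
Unshelve. all: by end_near. Qed.

(** d <= s provides the domination q_d <= q_s; larger times are reached by doubling. *)
Lemma cpois_sim_up s d : (0 < s)%R -> (0 <= d <= s)%R -> subexp (q s) ->
  sim ((s + d) / s * expR (lam * d))%R (q (s + d)) (q s).
Proof.
move=> s0 /andP[d0 ds] Q; have hQ := hq (ltW s0).
have dom x : q d x <= 1%:E * q s x by rewrite mul1e; apply: le_cpois.
have ad := conv_xmul_sim hQ Q (int_q (ltW s0)) (hq d0) (int_q d0) ler01 (near_pinftyW dom).
have Xpos := (uniformly_long_tailed_xmul Q.1).1.
apply: sim_xmul => e e0.
have k0 : (0 < (s + d) / s)%R by rewrite divr_gt0//; lra.
pose a := (e / ((s + d) / s))%R.
have a0 : (0 < a)%R by rewrite /a divr_gt0.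
have aE : ((s + d) / s * a = e)%R by rewrite /a mulrC divfK// gt_eqF.
near=> x.
have /fin_pos[b b0 XE] : 0 < xmul (q s) x < +oo by near: x.
have /andP[h1 h2] : (expR (lam * d) - 1 - a)%:E * xmul (q s) x <=
    convolution (q d) (xmul (q s)) x <=
    (expR (lam * d) - 1 + a)%:E * xmul (q s) x by near: x; exact: (ad a a0).
rewrite (xmul_cpoisD lam_gt0 hphi s0 d0).
rewrite XE -!EFinM in h1 h2 *.
have [y yE] := fin_between h1 h2; rewrite yE !lee_fin in h1 h2 *.
have k1 := ler_wpM2l (ltW k0) h1; have k2 := ler_wpM2l (ltW k0) h2.
have k3 : ((s + d) / s * a * b = e * b)%R by rewrite aE.
apply/andP; split; lra.
Unshelve. all: by end_near. Qed.

Lemma subexp_cpois_le s t : (0 < s <= t)%R -> subexp (q t) ->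
  subexp (q s) /\ sim (s / t * expR (- (lam * (t - s))))%R (q s) (q t).
Proof.
move=> /andP[s0 st] Q; have t0 : (0 < t)%R by lra.
have := @cpois_sim_down s (t - s) s0; rewrite subr_ge0 st subrKC => /(_ isT Q) S.
split=> //; apply: subexp_sim S Q; [|exact/hq/ltW|exact/hq/ltW].
by rewrite mulr_gt0 ?divr_gt0 ?expR_gt0.
Qed.

Lemma subexp_cpois_double s n : (0 < s)%R -> subexp (q s) ->
  subexp (q (2 ^+ n * s)%R).
Proof.
move=> s0 Q; elim: n => [|n ih]; first by rewrite expr0 mul1r.
set t := (2 ^+ n * s)%R in ih; have t0 : (0 < t)%R by rewrite mulr_gt0 ?exprn_gt0.
have -> : (2 ^+ n.+1 * s = t + t)%R by rewrite exprS /t; ring.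
have tt : (0 <= t <= t)%R by rewrite lexx ltW.
apply: subexp_sim (cpois_sim_up t0 tt ih) ih; last 2 first.
- by apply: hq; lra.
- by apply: hq; lra.
by rewrite mulr_gt0 ?expR_gt0 ?divr_gt0//; lra.
Qed.

(** Doubling reaches a time T above both t and 1, from which one descends to each of them. The
    constant is the quotient of (t / T) exp (- lam (T - t)) by (1 / T) exp (- lam (T - 1)), in which
    T cancels. *)
Lemma subexp_cpois_all s t : (0 < s)%R -> (0 < t)%R -> subexp (q s) ->
  subexp (q t) /\ sim (t * expR (lam * (t - 1)))%R (q t) (q 1%R).
Proof.
move=> s0 t0 Q.
have [n tn] : exists n : nat, (t + 1 <= 2 ^+ n * s)%R.
  exists (Num.truncn ((t + 1) / s)%R).+1; rewrite -ler_pdivrMr//.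
  rewrite (le_trans (ltW (truncnS_gt _)))//.
  by rewrite -natrX ler_nat ltnW// ltn_expl.
have QT := subexp_cpois_double n s0 Q.
move: (2 ^+ n * s)%R tn QT => T tT QT; have T0 : (0 < T)%R by lra.
have tT' : (0 < t <= T)%R by rewrite t0/=; lra.
have oT : (0 < 1 :> R)%R && (1 <= T)%R by apply/andP; split; lra.
have [Qt St] := subexp_cpois_le tT' QT; have [Q1 S1] := subexp_cpois_le oT QT.
split=> //.
have c1 : (0 < 1 / T * expR (- (lam * (T - 1))))%R by rewrite mulr_gt0 ?expR_gt0 ?divr_gt0.
have ct : (0 < t / T * expR (- (lam * (T - t))))%R by rewrite mulr_gt0 ?expR_gt0 ?divr_gt0.
have S1' := simV c1 QT.1.1 S1.
have := sim_trans ct _ Q1.1.1 St S1'; rewrite invr_gt0 => /(_ c1).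
congr (sim _ _ _).
rewrite invfM div1r invrK -expRN opprK mulrACA mulrC -expRD.
rewrite (_ : - (lam * (T - t)) + lam * (T - 1) = lam * (t - 1))%R; last by ring.
by rewrite mulrC divfK// gt_eqF.
Qed.

(** (1 - exp (- z)) / (exp z - 1) = exp (- z), with z = lam t. *)
Lemma cpoisson_density_factor t : (0 < t)%R ->
  (fun x => (1 - expR (- (lam * t)))%:E * cpoisson_density lam phi t x) =
  (fun x => (expR (- (lam * t)))%:E * q t x).
Proof.
move=> t0; rewrite (cpoisson_densityE lam_gt0 hphi (ltW t0)); apply/funext => x.
rewrite muleA -EFinM; congr (_%:E * _).
have : (1 < expR (lam * t))%R by rewrite expR_gt1 mulr_gt0.
rewrite expRN => E; field; rewrite subr_eq0 !gt_eqF//; lra.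
Qed.

Hypothesis phi_fin : forall x, phi x < +oo.
Hypothesis phi_L2 :
  \int[mu]_(x in [set x : R | (0 <= x)%R]) (phi x) ^+ 2 < +oo.

Lemma subexp_density_cpois t : (0 < t)%R ->
  subexp_density (cpoisson_density lam phi t) <-> subexp (q t).
Proof.
move=> t0; have pd := cpoisson_density_is_density lam_gt0 hphi phi_fin phi1 phi_L2 t0.
have := cpoisson_densityE lam_gt0 hphi (ltW t0).
have m0 : (0 < (expR (lam * t) - 1)^-1)%R by rewrite invr_gt0 subr_gt0 expR_gt1 mulr_gt0.
move: (expR (lam * t) - 1)^-1%R m0 => c c0 pE.
have ht := hq (ltW t0).
have hp : half_line (cpoisson_density lam phi t).
  by rewrite pE; apply: half_lineZ => //; exact: ltW.
rewrite subexp_density_half_line//; split.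
  apply: (subexp_sim (c := c^-1%R)) => //; first by rewrite invr_gt0.
  have -> : q t = fun x => c^-1%:E * cpoisson_density lam phi t x.
    by apply/funext => x; rewrite pE muleA -EFinM mulVf ?mul1e// gt_eqF.
  exact: (sim_scale _ hp.1.1).
apply: (subexp_sim c0) => //; rewrite pE; exact: (sim_scale _ ht.1.1).
Qed.

Lemma subexp_cpoisson_density_all s t : (0 < s)%R -> (0 < t)%R ->
  subexp_density (cpoisson_density lam phi s) ->
  subexp_density (cpoisson_density lam phi t) /\
  asymp_equiv
    (fun x => (1 - expR (- (lam * t)))%:E * cpoisson_density lam phi t x)
    (fun x => (t * (1 - expR (- lam)))%:E * cpoisson_density lam phi 1%R x).
Proof.
move=> s0 t0 /(subexp_density_cpois s0) Q.
have [Qt S] := subexp_cpois_all s0 t0 Q.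
have [Q1 _] := subexp_cpois_all s0 ltr01 Q.
split; first exact/subexp_density_cpois.
rewrite cpoisson_density_factor//.
have -> : (fun x => (t * (1 - expR (- lam)))%:E * cpoisson_density lam phi 1 x) =
    (fun x => (t * expR (- lam))%:E * q 1%R x).
  have e := cpoisson_density_factor (@ltr01 R); rewrite mulr1 in e.
  apply/funext => x; rewrite !EFinM -!muleA.
  by have := congr1 (fun f => f x) e => /= ->.
apply/asymp_equiv_simP; [exact: expR_gt0|by rewrite mulr_gt0 ?expR_gt0|].
split; [exact: Qt.1.1|exact: Q1.1.1|].
move: S; congr (sim _ _ _).
rewrite -mulrA -expRN opprK -expRD; congr (_ * expR _)%R; ring.
Qed.

End compound_poisson_subexponential.

(** * Exponential tilting and the converse *)

Section tilt.
Context {R : realType}.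
Local Notation mu := (@lebesgue_measure R).
Implicit Types f g h : R -> \bar R.

(* The weight x |-> exp (gam x) 1_{x <= X} is submultiplicative on the half-line. *)
Definition tilt (gam X : R) f : R -> \bar R :=
  fun x => (if (x <= X)%R then expR (gam * x) else 0%R)%:E * f x.

Lemma tilt_weight_ge0 (gam X x : R) :
  0 <= (if (x <= X)%R then expR (gam * x) else 0%R)%:E.
Proof. by rewrite lee_fin; case: ifP => // _; exact: expR_ge0. Qed.

Lemma measurable_tilt_weight (gam X : R) : measurable_fun [set: R]
  (fun x : R => (if (x <= X)%R then expR (gam * x) else 0%R)%:E).
Proof.
apply/measurable_EFinP; apply: measurable_fun_ifT => //.
- exact: measurable_fun_ler.
- by apply: measurableT_comp => //; exact: measurable_funM.
Qed.

Lemma half_line_tilt gam X f : half_line f -> half_line (tilt gam X f).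
Proof.
move=> [mf fn]; split; last by move=> x x0; rewrite /tilt fn// mule0.
apply: nn_measurableM => //; split; first exact: tilt_weight_ge0.
exact: measurable_tilt_weight.
Qed.

(** If x <= X, then u and x - u, lying in [0, x], are below the cut too and the exponentials
    multiply exactly; if x > X, the left-hand side vanishes. *)
Lemma tilt_conv_le gam X f g x : half_line f -> half_line g ->
  tilt gam X (convolution f g) x <= convolution (tilt gam X f) (tilt gam X g) x.
Proof.
move=> hf hg; have htf := half_line_tilt gam X hf; have htg := half_line_tilt gam X hg.
have mi := nn_measurable_conv_integrand x hf.1 hg.1.
have mt := nn_measurable_conv_integrand x htf.1 htg.1.
have [xX|xX] := leP x X; last first.
  by rewrite /tilt (leNgt x X) xX mul0e; exact: (half_line_conv htf htg).1.1.
rewrite {1}/tilt xX -nn_integralZl ?expR_ge0//.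
apply: nn_le_integral => // [|u]; first exact: (nn_measurableZ (expR_ge0 _) mi).
have [u0|u0] := ltP u 0%R; first by rewrite htg.2// hg.2// !mule0.
have [xu|xu] := ltP (x - u)%R 0%R; first by rewrite htf.2// hf.2// !mul0e mule0.
rewrite /tilt !ifT; [|lra|lra].
rewrite muleACA -EFinM -expRD (_ : gam * (x - u) + gam * u = gam * x)%R//; ring.
Qed.

Lemma le_tilt gam X f g x : f x <= g x -> tilt gam X f x <= tilt gam X g x.
Proof. by move=> fg; rewrite /tilt lee_wpmul2l// tilt_weight_ge0. Qed.

Lemma tiltD gam X f g x : 0 <= f x -> 0 <= g x ->
  tilt gam X (fun x => f x + g x) x = tilt gam X f x + tilt gam X g x.
Proof. by move=> f0 g0; rewrite /tilt ge0_muleDr. Qed.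

Lemma tiltZ gam X (c : R) f x :
  tilt gam X (fun x => c%:E * f x) x = c%:E * tilt gam X f x.
Proof. by rewrite /tilt muleCA. Qed.

Lemma tilt_low_le gam X B f x : (0 <= gam)%R -> half_line f ->
  tilt gam X (low B f) x <= (expR (gam * B))%:E * low B f x.
Proof.
move=> g0 hf; rewrite /tilt /low; have [xB|_] := ltP x B; last by rewrite !mule0.
rewrite lee_wpmul2r ?hf.1.1// lee_fin; case: ifP => _; last exact: expR_ge0.
by rewrite ler_expR ler_wpM2l// ltW.
Qed.

(** Eventually f (x - 1) <= (1 + e) f x with 1 + e <= exp gam, so exp (gam x) f x does not decrease
    along unit steps. On the first unit interval, e <= 1/2 keeps f above half of its value [b] at
    the right end. *)
Lemma long_tailed_exp_lower f (gam : R) : uniformly_long_tailed f -> (0 < gam)%R ->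
  exists M c : R, [/\ (1 <= M)%R, (0 < c)%R &
    forall x, (M <= x)%R -> c%:E <= (expR (gam * x))%:E * f x].
Proof.
move=> [fpos fu] g0.
pose e := (Num.min (expR gam - 1) (2^-1))%R.
have e0 : (0 < e)%R by rewrite lt_min subr_gt0 expR_gt1 g0/=.
have [M0 [_ HM]] : \forall x \near +oo%R, (1 < x)%R /\ (0 < f x < +oo /\
    forall u : R, (0 <= u <= 1)%R -> (1 - e)%:E * f x <= f (x - u)%R <= (1 + e)%:E * f x).
  near=> x; split; first by near: x; exact: near_pinfty_gt.
  by split; near: x; [exact: fpos|exact: fu].
pose M := (M0 + 1)%R.
have HM' x : (M <= x)%R -> (1 < x)%R /\ (0 < f x < +oo /\
    forall u : R, (0 <= u <= 1)%R -> (1 - e)%:E * f x <= f (x - u)%R <= (1 + e)%:E * f x).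
  by move=> Mx; apply: HM; rewrite /M in Mx; lra.
have [_ [/fin_pos[b b0 bE] hb]] := HM' (M + 1)%R ltac:(lra).
have [M1 _] := HM' M (lexx M).
have e12 : (e <= 2^-1)%R by rewrite ge_min lexx orbT.
have eg : (1 + e <= expR gam)%R.
  have : (e <= expR gam - 1)%R by rewrite ge_min lexx.
  lra.
exists M, (expR (gam * M) * (b / 2))%R; split; [exact: ltW| |].
  by rewrite mulr_gt0 ?expR_gt0 ?divr_gt0.
suff H : forall n x, (M <= x <= M + n.+1%:R)%R ->
    (expR (gam * M) * (b / 2))%:E <= (expR (gam * x))%:E * f x.
  move=> x Mx; apply: (H (Num.truncn (x - M)%R)).
  by rewrite Mx/= -lerBlDl ltW// truncnS_gt.
elim=> [|n ih] x /andP[Mx xn].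
  have /andP[+ _] : (1 - e)%:E * f (M + 1)%R <= f (M + 1 - (M + 1 - x))%R <=
      (1 + e)%:E * f (M + 1)%R by apply: hb; lra.
  rewrite subKr bE -EFinM => h; rewrite [leLHS]EFinM.
  apply: lee_pmul; rewrite ?lee_fin ?expR_ge0//.
  - by rewrite divr_ge0// ltW.
  - by rewrite ler_expR ler_pM2l.
  - by apply: le_trans h; rewrite lee_fin mulrC ler_wpM2r ?(ltW b0)//; lra.
have [xn'|xn'] := leP x (M + n.+1%:R)%R; first by apply: ih; rewrite Mx.
have n1 : (1 <= n.+1%:R :> R)%R by rewrite ler1n.
have nS : (n.+2%:R = n.+1%:R + 1 :> R)%R by rewrite -natr1.
rewrite nS in xn.
have {}ih := ih (x - 1)%R ltac:(lra).
apply: (le_trans ih).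
have [_ [/fin_pos[a a0 aE] ha]] := HM' x ltac:(lra).
have /andP[_ h] := ha 1%R ltac:(lra).
have -> : (gam * x = gam * (x - 1) + gam)%R by ring.
rewrite expRD EFinM -muleA; apply: lee_wpmul2l; first by rewrite lee_fin expR_ge0.
by apply: (le_trans h); rewrite aE -!EFinM lee_fin ler_wpM2r// ltW.
Unshelve. all: by end_near. Qed.

Lemma integral_tilt_unbounded f (gam N : R) : half_line f ->
  uniformly_long_tailed f -> (0 < gam)%R -> exists2 X : R, (0 < X)%R &
    N%:E <= \int[mu]_x tilt gam X (xmul f) x.
Proof.
move=> hf fu g0; have [M [c [M1 c0 H]]] := long_tailed_exp_lower fu g0.
pose X := (M + Num.max 0 (N / c))%R.
have XM : (M <= X)%R by rewrite /X lerDl le_max lexx.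
exists X; first lra.
have hx := half_line_tilt gam X (half_line_xmul hf).
apply: (@le_trans _ _ (\int[mu]_(x in `[M, X]) c%:E)).
  rewrite integral_cst//= lebesgue_measure_itv/= lte_fin.
  have cX : (N <= c * (X - M))%R.
    by rewrite /X addrC addKr -ler_pdivrMl// mulrC le_max lexx orbT.
  case: ifPn => [_|]; first by rewrite -EFinD -EFinM lee_fin.
  rewrite -leNgt => MX; rewrite mule0 lee_fin; apply: (le_trans cX).
  by rewrite mulr_ge0_le0 ?(ltW c0)// subr_le0.
apply: (@le_trans _ _ (\int[mu]_(x in `[M, X]) tilt gam X (xmul f) x)).
  apply: ge0_le_integral => //.
  - by move=> x _; rewrite lee_fin ltW.
  - by apply: measurable_funS hx.1.2.
  - move=> x /=; rewrite in_itv/= => /andP[Mx xX].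
    rewrite /tilt xX xmulE; last lra.
    rewrite muleCA; apply: (le_trans (H x Mx)).
    have p : 0 <= (expR (gam * x))%:E * f x.
      by rewrite mule_ge0 ?lee_fin ?expR_ge0// hf.1.1.
    by rewrite -[leLHS]mul1e lee_wpmul2r// lee_fin; lra.
by apply: ge0_subset_integral => //; [exact: hx.1.2|move=> x _; exact: hx.1.1].
Qed.

(** Intermediate value theorem in the cut X: the integral is 0 at X = 0, reaches N by
    [integral_tilt_unbounded], and is continuous because the weight is bounded on bounded intervals
    and f is integrable. *)
Lemma integral_tilt_eq f (m gam N : R) : half_line f -> (forall x, f x < +oo) ->
  \int[mu]_x f x = m%:E -> uniformly_long_tailed f -> (0 < gam)%R -> (0 <= N)%R ->
  exists X : R, \int[mu]_x tilt gam X (xmul f) x = N%:E.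
Proof.
move=> hf ffin fm fu g0 N0.
have [X1 X10 NX1] := integral_tilt_unbounded N hf fu g0.
pose g (x : R) := (expR (gam * x) * (Num.max x 0 * fine (f x)))%R.
have fE x : f x = (fine (f x))%:E.
  by rewrite fineK// ge0_fin_numE; [exact: ffin|exact: hf.1.1].
have gE x X : (x <= X)%R -> tilt gam X (xmul f) x = (g x)%:E.
  by move=> xX; rewrite /tilt xX /xmul fE -!EFinM.
have tE X : \int[mu]_x tilt gam X (xmul f) x = \int[mu]_(x in `[0%R, X]) (g x)%:E.
  rewrite [RHS]integral_mkcond; apply: eq_integral => x _; rewrite patchE.
  case: ifPn; first by rewrite inE/= in_itv/= => /andP[_ xX]; rewrite gE.
  rewrite notin_setE/= in_itv/= => /negP; rewrite negb_and -!ltNge => /orP[x0|xX].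
    by rewrite (half_line_tilt _ _ (half_line_xmul hf)).2.
  by rewrite /tilt (leNgt x X) xX mul0e.
have ig X : (X <= X1)%R -> mu.-integrable `[0%R, X] (EFin \o g).
  move=> XX1; have hx := half_line_tilt gam X1 (half_line_xmul hf).
  apply/integrableP; split.
    apply: (@eq_measurable_fun _ _ _ _ _ (tilt gam X1 (xmul f))).
      by move=> x; rewrite inE/= in_itv/= => /andP[_ xX]; rewrite gE//; lra.
    by apply: measurable_funS hx.1.2.
  have hc : (0 <= expR (gam * X1) * X1)%R by rewrite mulr_ge0 ?expR_ge0// ltW.
  apply: (@le_lt_trans _ _ (\int[mu]_x ((expR (gam * X1) * X1)%:E * f x))); last first.
    by rewrite nn_integralZl ?fm -?EFinM ?ltry//; exact: hf.1.
  rewrite integral_mkcond; apply: ge0_le_integral => //.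
  - by move=> x _; rewrite erestrict_ge0.
  - apply/(measurable_restrictT _ _).1 => //.
    apply: measurableT_comp => //.
    apply: (@eq_measurable_fun _ _ _ _ _ (tilt gam X1 (xmul f))).
      by move=> x; rewrite inE/= in_itv/= => /andP[_ xX]; rewrite gE//; lra.
    by apply: measurable_funS hx.1.2.
  - exact: (half_lineZ hc hf).1.2.
  - move=> x _; rewrite patchE; case: ifPn => [|_]; last first.
      exact: (half_lineZ hc hf).1.1.
    rewrite inE/= in_itv/= => /andP[x0 xX].
    have f0 : (0 <= fine (f x))%R by rewrite -lee_fin -fE; exact: hf.1.1.
    have g0x : (0 <= g x)%R by rewrite /g mulr_ge0 ?expR_ge0// mulr_ge0// le_max lexx orbT.
    rewrite ger0_norm// fE lee_fin /g mulrA ler_wpM2r// ler_pM ?expR_ge0//.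
    + by rewrite le_max lexx orbT.
    + by rewrite ler_expR ler_pM2l//; lra.
    + by rewrite max_l//; lra.
pose J X := (\int[mu]_(x in `[0%R, X]) g x)%R.
have JE X : (X <= X1)%R -> \int[mu]_x tilt gam X (xmul f) x = (J X)%:E.
  move=> XX1; rewrite tE /J /Rintegral fineK//.
  exact: (integrable_fin_num _ (ig X XX1)).
have cJ : {within `[0%R, X1], continuous J}.
  exact: (parameterized_integral_continuous (ltW X10) (ig X1 (lexx _))).
have J0 : J 0%R = 0%R by rewrite /J set_itv1 Rintegral_set1.
have JX1 : (N <= J X1)%R by rewrite -lee_fin -JE.
have [|X] := @IVT R J 0%R X1 N (ltW X10) cJ.
  by rewrite J0 ge_min N0/= le_max JX1 orbT.
rewrite in_itv/= => /andP[_ XX1] JX; exists X.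
by rewrite JE// JX.
Qed.

End tilt.

(** * From one ratio limit back to subexponentiality *)

Section compound_poisson_converse.
Context {R : realType}.
Local Notation mu := (@lebesgue_measure R).
Variables (lam : R) (phi : R -> \bar R).
Hypothesis lam_gt0 : (0 < lam)%R.
Hypothesis hphi : half_line phi.
Hypothesis phi1 : \int[mu]_x phi x = 1.
Implicit Types s t d : R.

Local Notation q := (cpois lam phi).
Let hq t := half_line_cpois lam_gt0 hphi (t := t).
Let int_q t := integral_cpois lam_gt0 hphi phi1 (t := t).

(** One-sided form of the limit in [cpois_sim_up]: limsup q_(s+d) / q_s is at most the value it has
    in the subexponential case. *)
Definition upper_ratio s d := forall e : R, (0 < e)%R -> \forall x \near +oo%R,
  q (s + d)%R x <= ((s + d) / s * expR (lam * d) + e)%:E * q s x.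

Lemma tilt_cpoisD gam X s d : (0 < s)%R -> (0 <= d)%R ->
  \int[mu]_x tilt gam X (xmul (q (s + d)%R)) x <= ((s + d) / s)%:E *
    (\int[mu]_x tilt gam X (xmul (q s)) x +
     \int[mu]_x tilt gam X (q d) x * \int[mu]_x tilt gam X (xmul (q s)) x).
Proof.
move=> s0 d0; have k0 : (0 <= (s + d) / s)%R by rewrite divr_ge0//; lra.
have hx := half_line_xmul (hq (ltW s0)).
have htx := half_line_tilt gam X hx; have htd := half_line_tilt gam X (hq d0).
have hc := half_line_conv (hq d0) hx.
rewrite -integral_conv; [|exact: htd.1|exact: htx.1].
rewrite -nn_integralD; [|exact: htx.1|exact: (half_line_conv htd htx).1].
rewrite -nn_integralZl//; last exact: (half_lineD htx (half_line_conv htd htx)).1.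
apply: nn_le_integral => [||x].
- by apply: (half_line_tilt _ _ _).1; apply/half_line_xmul/hq; lra.
- exact: (half_lineZ k0 (half_lineD htx (half_line_conv htd htx))).1.
rewrite (xmul_cpoisD lam_gt0 hphi s0 d0) tiltZ lee_wpmul2l// tiltD; last 2 first.
- exact: hx.1.1.
- exact: hc.1.1.
by apply: leeD2l; exact: (tilt_conv_le _ _ _ (hq d0) hx).
Qed.

Lemma le_of_large (a b c : R) :
  (\forall N \near +oo%R, (a * N <= b * N + c)%R) -> (a <= b)%R.
Proof.
move=> [M [_ HM]]; rewrite leNgt; apply/negP => ba.
pose N := (Num.max M (Num.max 0 (c / (a - b))) + 1)%R.
have hM : (M <= Num.max M (Num.max 0 (c / (a - b))))%R by rewrite le_max lexx.
have hc : (c / (a - b) <= Num.max M (Num.max 0 (c / (a - b))))%R.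
  by rewrite !le_max lexx !orbT.
have := HM N ltac:(rewrite /N; lra).
have : (c < N * (a - b))%R by rewrite -ltr_pdivrMr ?subr_gt0// /N; lra.
lra.
Qed.

Hypothesis phi_fin : forall x, phi x < +oo.
Hypothesis phi_L2 :
  \int[mu]_(x in [set x : R | (0 <= x)%R]) (phi x) ^+ 2 < +oo.
Let q_fin t := fun x => cpois_fin lam_gt0 hphi phi_fin phi1 phi_L2 x (t := t).

(* Tilting with [int x w(x) q s x dx = N], then letting N tend to infinity with
   the tilt parameter N^-3: the mass of q d is asymptotically unchanged while
   bounded regions contribute O(1) to N. *)
Lemma sim_cpois_le s d K : (0 < s)%R -> (0 < d)%R ->
  uniformly_long_tailed (q s) -> (0 < K)%R -> sim K (q (s + d)%R) (q s) ->
  (K <= (s + d) / s * expR (lam * d))%R.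
Proof.
move=> s0 d0 su K0 sK; have sd0 : (0 < s + d)%R by lra.
apply/ler_addgt0Pr => e e0.
have k0 : (0 < (s + d) / s)%R by rewrite divr_gt0.
(* e' < K keeps the lower factor K - e' positive. *)
have [e' e'0 [e'K e'e]] : exists2 e', (0 < e')%R & (e' < K)%R /\ (e' <= e)%R.
  exists (Num.min (K / 2) e)%R; first by rewrite lt_min divr_gt0// e0.
  by split; [rewrite gt_min ltr_pdivrMr//; apply/orP; left; lra|rewrite ge_min lexx orbT].
have hs := hq (ltW s0); have hd := hq (ltW d0); have hsd := hq (ltW sd0).
have hx := half_line_xmul hs; have hxsd := half_line_xmul hsd.
have [M [_ HM]] : \forall x \near +oo%R,
    (K - e')%:E * q s x <= q (s + d)%R x <= (2 * K)%:E * q s x.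
  near=> y; apply/andP; split.
    have /andP[]// : (K - e')%:E * q s y <= q (s + d)%R y <= (K + e')%:E * q s y.
    by near: y; exact: (sK e' e'0).
  have /andP[_] : (K - K)%:E * q s y <= q (s + d)%R y <= (K + K)%:E * q s y.
    by near: y; exact: (sK K K0).
  by rewrite (_ : K + K = 2 * K)%R//; lra.
have [B B0 MB] : exists2 B, (0 < B)%R & (M < B)%R.
  exists (Num.max M 0 + 1)%R; first by rewrite ltr_pwDr// le_max lexx orbT.
  by rewrite (@le_lt_trans _ _ (Num.max M 0)%R) ?ltrDl// le_max lexx.
have HB x : (B <= x)%R -> (K - e')%:E * q s x <= q (s + d)%R x <= (2 * K)%:E * q s x.
  by move=> Bx; apply: HM; exact: lt_le_trans Bx.
set md := (expR (lam * d) - 1)%R; set ms := (expR (lam * s) - 1)%R.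
have md0 : (0 <= md)%R by rewrite subr_ge0 -expR0 ler_expR mulr_ge0 ?ltW.
have ms0 : (0 <= ms)%R by rewrite subr_ge0 -expR0 ler_expR mulr_ge0 ?ltW.
suff H : (K - e' <= (s + d) / s * (1 + md))%R.
  by rewrite (_ : 1 + md = expR (lam * d))%R in H; [lra|rewrite /md; ring].
(* Only the coefficients of N matter. The constant collects the loss below B on the left and, on the
   right, N times the two errors in the tilted mass of q_d. *)
apply: (@le_of_large _ _ ((K - e') * (expR 1 * B * ms)
   + (s + d) / s * (2 * md + 2 * K))%R).
near=> N.
have N2 : (2 < N)%R by near: N; exact: near_pinfty_gt.
have NB : (B < N)%R by near: N; exact: near_pinfty_gt.
have N0 : (0 < N)%R by lra.
(* On [0, N^2] the weight is at most exp (1 / N). Beyond N^2, q_d <= 2 K q_s <= (2 K / N^2) M q_s,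
   whose tilted integral is at most 2 K / N. *)
pose gam := (N^-1 ^+ 3)%R.
have gam0 : (0 < gam)%R by rewrite exprn_gt0// invr_gt0.
have gN : (gam * (N * N) = N^-1)%R by rewrite /gam; field; rewrite gt_eqF.
have NN : (N <= N * N)%R by rewrite -[leLHS]mul1r ler_wpM2r//; lra.
have [X JN] := integral_tilt_eq hs (fun x => q_fin x (ltW s0)) (int_q (ltW s0)) su gam0 (ltW N0).
have htx := half_line_tilt gam X hx; have htd := half_line_tilt gam X hd.
have htsd := half_line_tilt gam X hxsd.
have expN : (expR N^-1 <= 1 + 2 / N)%R.
  have h := expR_ge1Dx (- N^-1)%R; rewrite expRN in h.
  have iN : (N * N^-1 = 1)%R by rewrite mulfV// gt_eqF.
  have y2 : (N^-1 <= 2^-1)%R by rewrite lef_pV2 ?posrE//; lra.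
  have y0 : (0 < N^-1)%R by rewrite invr_gt0.
  have E0 := expR_gt0 N^-1%R.
  have : ((1 - N^-1) * expR N^-1 <= 1)%R.
    by rewrite -[leRHS](mulVf (lt0r_neq0 E0)) ler_wpM2r// ltW.
  move: (expR N^-1%R) E0 => E E0 hE.
  have : ((1 - N^-1) * E <= (1 - N^-1) * (1 + 2 / N))%R.
    apply: (le_trans hE); nra.
  by rewrite ler_pM2l//; lra.
have D : \int[mu]_x tilt gam X (q d) x <= (expR N^-1 * md + 2 * K / (N * N) * N)%:E.
  have hl := half_line_low (N * N) hd.
  have hz1 := half_lineZ (expR_ge0 N^-1%R) hl.
  have c0 : (0 <= 2 * K / (N * N))%R by rewrite divr_ge0 ?mulr_ge0 ?ltW.
  have hz2 := half_lineZ c0 htx.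
  apply: (@le_trans _ _ (\int[mu]_x ((expR N^-1)%:E * low (N * N) (q d) x +
      (2 * K / (N * N))%:E * tilt gam X (xmul (q s)) x))).
    apply: nn_le_integral => [||x]; [exact: htd.1|exact: (half_lineD hz1 hz2).1|].
    have [xN|xN] := ltP x (N * N)%R.
      apply: (@le_trans _ _ (tilt gam X (low (N * N) (q d)) x)).
        by apply: le_tilt; rewrite /low xN.
      apply: (le_trans (tilt_low_le _ _ _ (ltW gam0) hd)).
      by rewrite gN leeDl// hz2.1.1.
    rewrite -tiltZ; apply: (@le_trans _ _ (tilt gam X (fun x0 => (2 * K / (N * N))%:E * xmul (q s) x0) x)).
      apply: le_tilt; have Bx : (B <= x)%R by lra.
      have /andP[_ h] := HB x Bx.
      apply: (@le_trans _ _ (q (s + d)%R x)).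
        by apply: (le_cpois lam_gt0 hphi _ (ltW d0)); rewrite lerDr ltW.
      apply: (le_trans h); rewrite xmulE; last lra.
      rewrite muleA -EFinM lee_wpmul2r ?hs.1.1// lee_fin.
      have -> : (2 * K / (N * N) * x = 2 * K * (x / (N * N)))%R by ring.
      rewrite -[leLHS]mulr1 ler_wpM2l//; first lra.
      by rewrite ler_pdivlMr ?mul1r// mulr_gt0.
    by rewrite leeDr// hz1.1.1.
  rewrite nn_integralD; [|exact: hz1.1|exact: hz2.1].
  rewrite nn_integralZl ?expR_ge0//; last exact: hl.1.
  rewrite nn_integralZl//; last exact: htx.1.
  rewrite JN EFinD EFinM [in leRHS]EFinM leeD// lee_wpmul2l ?lee_fin ?expR_ge0//.
  rewrite -(int_q (ltW d0)).
  by apply: nn_le_integral => [||x]; [exact: hl.1|exact: hd.1|exact: low_le].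
(* The comparison q_(s+d) >= (K - e') q_s holds from B on; the part of M q_s below B has tilted
   integral at most exp 1 * B * ms, whatever N is, since gam B <= 1. *)
have L : (((K - e') * (N - expR 1 * B * ms))%:E <=
    \int[mu]_x tilt gam X (xmul (q (s + d)%R)) x).
  have hh := half_line_high B hx; have hth := half_line_tilt gam X hh.
  have hl := half_line_low B hx; have htl := half_line_tilt gam X hl.
  have Ke : (0 <= K - e')%R by lra.
  have c0 : (0 <= expR 1 * B)%R by rewrite mulr_ge0 ?expR_ge0// ltW.
  have h1 : \int[mu]_x tilt gam X (low B (xmul (q s))) x <= (expR 1 * B * ms)%:E.
    rewrite EFinM -(int_q (ltW s0)) -nn_integralZl//; last exact: hs.1.
    apply: nn_le_integral => [||x]; [exact: htl.1|exact: (half_lineZ c0 hs).1|].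
    apply: (le_trans (tilt_low_le _ _ _ (ltW gam0) hx)).
    rewrite EFinM -muleA; apply: lee_pmul.
    - by rewrite lee_fin expR_ge0.
    - exact: hl.1.1.
    - rewrite lee_fin ler_expR.
      have h : (N^-1 <= 1)%R by rewrite invf_le1//; lra.
      have gB : (gam * B <= gam * (N * N))%R by rewrite ler_wpM2l ?(ltW gam0)//; lra.
      lra.
    - rewrite /low /xmul; case: ifPn => xB.
        by rewrite lee_wpmul2r ?hs.1.1// lee_fin ge_max !ltW.
      by rewrite mule_ge0 ?hs.1.1// lee_fin ltW.
  have h2 : \int[mu]_x tilt gam X (xmul (q s)) x =
      \int[mu]_x tilt gam X (low B (xmul (q s))) x +
      \int[mu]_x tilt gam X (high B (xmul (q s))) x.
    rewrite -nn_integralD; [|exact: htl.1|exact: hth.1].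
    apply: eq_integral => x _; rewrite -tiltD ?hl.1.1 ?hh.1.1//.
    by rewrite /tilt -low_high.
  have h3 : (K - e')%:E * \int[mu]_x tilt gam X (high B (xmul (q s))) x <=
      \int[mu]_x tilt gam X (xmul (q (s + d)%R)) x.
    rewrite -nn_integralZl//; last exact: hth.1.
    apply: nn_le_integral => [||x]; [exact: (half_lineZ Ke hth).1|exact: htsd.1|].
    rewrite -tiltZ; apply: le_tilt; rewrite /high; case: ifPn => [_|].
      by rewrite mule0; exact: hxsd.1.1.
    rewrite -leNgt => Bx; have /andP[h _] := HB x Bx.
    have x0 : (0 <= x)%R := ltW (lt_le_trans B0 Bx).
    by rewrite !xmulE// muleCA lee_wpmul2l.
  apply: le_trans h3; rewrite EFinM lee_wpmul2l ?lee_fin//.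
  move: h1 h2; rewrite JN.
  have := nn_integral_ge0 htl.1; have := nn_integral_ge0 hth.1.
  case: (\int[mu]_x tilt gam X (low B (xmul (q s))) x) => [a| |]//.
  case: (\int[mu]_x tilt gam X (high B (xmul (q s))) x) => [b| |]//.
  rewrite !lee_fin -EFinD => _ _ ? [?]; lra.
have := le_trans L (tilt_cpoisD gam X s0 (ltW d0)); rewrite JN => U.
have {}U : ((K - e') * (N - expR 1 * B * ms) <=
   (s + d) / s * (N + (expR N^-1 * md + 2 * K / (N * N) * N) * N))%R.
  rewrite -lee_fin; apply: (le_trans U); rewrite [leRHS]EFinM lee_wpmul2l ?lee_fin ?(ltW k0)//.
  by rewrite [leRHS]EFinD leeD2l// [leRHS]EFinM lee_wpmul2r// lee_fin ltW.
clear -U k0 md0 N0 N2 K0 expN.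
have E1 : (2 * K / (N * N) * N * N = 2 * K)%R by field; rewrite gt_eqF.
have E2 : (expR N^-1 * md * N <= (1 + 2 / N) * md * N)%R.
  by rewrite ler_wpM2r ?(ltW N0)// ler_wpM2r.
have E3 : ((1 + 2 / N) * md * N = md * N + 2 * md)%R by field; rewrite gt_eqF.
have U2 : ((s + d) / s * (N + (expR N^-1 * md + 2 * K / (N * N) * N) * N) <=
    (s + d) / s * (N + md * N + 2 * md + 2 * K))%R.
  by rewrite ler_wpM2l ?(ltW k0)//; lra.
have := le_trans U U2; lra.
Unshelve. all: by end_near. Qed.

(** The identity from s + d to s + 2d involves q_d * M q_(s+d). Replacing M q_(s+d) by about c M q_s
    reduces it to q_d * M q_s, which the identity at s expresses through M q_(s+d), to be bounded
    once more. The replacement fails only for arguments below B, at a cost O(q_s) = o(M q_s). *)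
Lemma upper_ratio_double s d : (0 < s)%R -> (0 < d)%R ->
  uniformly_long_tailed (q s) -> upper_ratio s d -> upper_ratio s (d + d).
Proof.
rewrite /upper_ratio => s0 d0 su P e e0; have sd0 : (0 < s + d)%R by lra.
have sdd0 : (0 < s + d + d)%R by lra.
have d_sd : (d <= s + d)%R by lra.
have hs := hq (ltW s0); have hd := hq (ltW d0); have hsd := hq (ltW sd0).
have hx := half_line_xmul hs; have hxsd := half_line_xmul hsd.
set c := ((s + d) / s * expR (lam * d))%R in P *.
have c0 : (0 < c)%R by rewrite mulr_gt0 ?expR_gt0// divr_gt0.
pose k2 := ((s + d + d) / (s + d))%R; pose k1 := (s / (s + d))%R.
have k20 : (0 < k2)%R by rewrite divr_gt0.
have k10 : (0 < k1)%R by rewrite divr_gt0.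
(* c^2 has the factor ((s + d) / s)^2, which k reduces to (s + 2d) / s. *)
pose k := (k2 * k1)%R; have kpos : (0 < k)%R by rewrite mulr_gt0.
have target : ((s + (d + d)) / s * expR (lam * (d + d)) = k * (c * c))%R.
  rewrite mulrDr expRD /k /k2 /k1 /c; field; rewrite !gt_eqF//.
have k1E : (k1 * ((s + d) / s) = 1)%R by rewrite /k1; field; rewrite !gt_eqF.
have k2E : ((s + d + d) / (s + d) = k2)%R by [].
have kE : (k = k2 * k1)%R by [].
clearbody c k k1 k2.
pose e1 := (Num.min 1 (e / (2 * (k * (2 * c + 1)))))%R.
have z1 : (0 < 2 * c + 1)%R by rewrite addr_gt0// mulr_gt0.
have z0 : (0 < 2 * (k * (2 * c + 1)))%R by apply: mulr_gt0 => //; exact: mulr_gt0.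
have e10 : (0 < e1)%R by rewrite lt_min ltr01 divr_gt0.
have e11 : (e1 <= 1)%R by rewrite ge_min lexx.
have e1e : (e1 * (2 * (k * (2 * c + 1))) <= e)%R.
  by rewrite -ler_pdivlMr// ge_min lexx orbT.
move: e1 => e1 in e10 e11 e1e *.
have [B [_ HB0]] := P e1 e10.
have {}HB x : (Num.max B 0 + 1 <= x)%R -> q (s + d)%R x <= (c + e1)%:E * q s x.
  move=> Bx; apply: HB0; apply: lt_le_trans Bx.
  by rewrite (@le_lt_trans _ _ (Num.max B 0)%R) ?ltrDl// le_max lexx.
have B'0 : (0 < Num.max B 0 + 1)%R.
  by rewrite ltr_pwDr// le_max lexx orbT.
move: (Num.max B 0 + 1)%R B'0 HB => {HB0} {}B B0 HB.
have hl := half_line_low B hxsd.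
have [l lE] : exists l : R, \int[mu]_x low B (xmul (q (s + d)%R)) x = l%:E.
  have up : \int[mu]_x low B (xmul (q (s + d)%R)) x <= (B * (expR (lam * (s + d)) - 1))%:E.
    rewrite EFinM -(int_q (ltW sd0)) -nn_integralZl ?(ltW B0)//; last exact: hsd.1.
    apply: nn_le_integral => [||x]; [exact: hl.1|exact: (half_lineZ (ltW B0) hsd).1|].
    rewrite /low /xmul; case: ifPn => xB.
      by rewrite lee_wpmul2r ?hsd.1.1// lee_fin ge_max !ltW.
    by rewrite mule_ge0 ?hsd.1.1// lee_fin ltW.
  by have [l lE] := fin_between (nn_integral_ge0 hl.1) up; exists l.
have l0 : (0 <= l)%R by rewrite -lee_fin -lE; apply: nn_integral_ge0; exact: hl.1.
have ce0 : (0 <= c + e1)%R by lra.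
have lowlow : low B (low B (xmul (q (s + d)%R))) = low B (xmul (q (s + d)%R)).
  by apply/funext => x; rewrite /low; have [] := ltP x B.
near=> x.
have Bx : (B <= x)%R by apply: ltW; near: x; exact: near_pinfty_gt.
have B2x : (2 * B <= x)%R by apply: ltW; near: x; exact: near_pinfty_gt.
have x0 : (0 < x)%R by lra.
have xmu u : (u < B)%R -> (B <= x - u)%R by move=> uB; lra.
have lx : (k2 * (c + e1) * 2 * l / (e / 2) < x)%R by near: x; exact: near_pinfty_gt.
have /fin_pos[b b0 bE] : 0 < q s x < +oo by near: x; exact: su.1.
have h1 : convolution (q d) (low B (xmul (q (s + d)%R))) x <= ((c + e1) * (2 * l * b))%:E.
  have mi := nn_measurable_conv_integrand x hd.1 hl.1.
  have mi2 := nn_measurable_conv_integrand x hs.1 hl.1.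
  apply: (@le_trans _ _ ((c + e1)%:E * convolution (q s) (low B (xmul (q (s + d)%R))) x)).
    rewrite -(nn_integralZl ce0 mi2).
    apply: nn_le_integral => [||u]; [exact: mi|exact: (nn_measurableZ ce0 mi2)|].
    rewrite muleA; have [uB|uB] := ltP u B; last first.
      by rewrite /low ltNge uB !mule0.
    rewrite lee_wpmul2r ?hl.1.1//.
    apply: (@le_trans _ _ (q (s + d)%R (x - u)%R)); first exact: (le_cpois lam_gt0 hphi _ (ltW d0) d_sd).
    exact: (HB _ (xmu _ uB)).
  rewrite EFinM lee_wpmul2l ?lee_fin//.
  have : ((1 - 1) * l)%:E * q s x <= convolution (q s) (low B (low B (xmul (q (s + d)%R)))) x
      <= ((1 + 1) * l)%:E * q s x.
    near: x; apply: conv_low => //; [exact: hs.1|by rewrite lowlow|by rewrite ltr01 lexx].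
  by rewrite lowlow bE -!EFinM => /andP[].
have h2 : xmul (q (s + d)%R) x <= ((c + e1) * (x * b))%:E.
  rewrite xmulE ?(ltW x0)// EFinM [in leRHS]EFinM muleCA lee_wpmul2l ?lee_fin ?(ltW x0)//.
  by apply: (le_trans (HB x Bx)); rewrite bE.
have h3 : xmul (q s) x + convolution (q d) (xmul (q s)) x = k1%:E * xmul (q (s + d)%R) x.
  rewrite (xmul_cpoisD lam_gt0 hphi s0 (ltW d0)) muleA -EFinM.
  by rewrite k1E mul1e.
have h4 : convolution (q d) (xmul (q (s + d)%R)) x <=
    (c + e1)%:E * convolution (q d) (xmul (q s)) x +
    convolution (q d) (low B (xmul (q (s + d)%R))) x.
  have hz := half_lineZ ce0 hx.
  have -> : (c + e1)%:E * convolution (q d) (xmul (q s)) x =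
      convolution (q d) (fun y => (c + e1)%:E * xmul (q s) y) x.
    by rewrite convZr//; [exact: hd.1|exact: hx.1].
  have := @convDr R (q d) _ (low B (xmul (q (s + d)%R))) hd.1 hz.1 hl.1.
  move=> /(congr1 (fun f => f x)) /= <-.
  apply: le_conv => // [||||y]; [exact: hd.1|exact: hxsd.1|exact: hd.1
    |exact: (half_lineD hz hl).1|].
  rewrite /low; have [yB|yB] := ltP y B; first by rewrite leeDr// hz.1.1.
  have y0 : (0 <= y)%R by exact: le_trans (ltW B0) yB.
  rewrite adde0 (xmulE _ y0) (xmulE _ y0) muleCA.
  by apply: lee_wpmul2l; [rewrite lee_fin|exact: HB].
have fin0 := hxsd.1.1 x; have [Y YE] := fin_between fin0 h2.
have c1 := (half_line_conv hd hx).1.1 x.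
have xqE : xmul (q s) x = (x * b)%:E by rewrite xmulE ?(ltW x0)// bE.
have [V VE] : exists V : R, convolution (q d) (xmul (q s)) x = V%:E.
  by move: h3 c1; rewrite YE xqE; case: (convolution _ _ x) => [V||]//; exists V.
rewrite YE xqE VE -EFinM -EFinD in h3; case: h3 => h3.
rewrite VE in h4; have h5 := le_trans h4 (leeD2l _ h1).
rewrite -EFinM -EFinD in h5.
have [W WE] := fin_between ((half_line_conv hd hxsd).1.1 x) h5.
rewrite WE !lee_fin in h5; rewrite YE lee_fin in h2.
have := congr1 (fun f => f x) (xmul_cpoisD lam_gt0 hphi sd0 (ltW d0)).
rewrite /= YE WE -EFinD -EFinM xmulE ?(ltW x0)// k2E target addrA bE -EFinM => E.
rewrite -(@lee_pmul2l _ x%:E) ?lte_fin// E -EFinM lee_fin.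
have xb : (0 < x * b)%R by rewrite mulr_gt0.
clear -h2 h3 h5 ce0 k10 k20 kpos kE lx e0 e10 e11 e1e c0 b0 x0 xb.
have i1 : (Y + W <= (c + e1) * (k1 * ((c + e1) * (x * b))) + (c + e1) * (2 * l * b))%R.
  have j : ((c + e1) * (k1 * Y) <= (c + e1) * (k1 * ((c + e1) * (x * b))))%R.
    by rewrite ler_wpM2l// ler_wpM2l// ltW.
  have : ((c + e1) * (x * b + V) = (c + e1) * (k1 * Y))%R by rewrite h3.
  lra.
apply: (le_trans (ler_wpM2l (ltW k20) i1)).
have i2 : (k2 * ((c + e1) * (2 * l * b)) <= e / 2 * (x * b))%R.
  have : (k2 * (c + e1) * 2 * l * b <= x * (e / 2) * b)%R.
    by rewrite ler_wpM2r ?(ltW b0)// -ler_pdivrMr ?divr_gt0// ltW.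
  lra.
have i3 : (k * ((c + e1) * (c + e1)) <= k * (c * c) + e / 2)%R.
  have e12 : (e1 * e1 <= e1)%R by rewrite -[leRHS]mul1r ler_wpM2r// ltW.
  have : (k * ((c + e1) * (c + e1)) <= k * (c * c + e1 * (2 * c + 1)))%R.
    by rewrite ler_wpM2l ?(ltW kpos)//; lra.
  lra.
have i4 : (k * ((c + e1) * (c + e1)) * (x * b) <= (k * (c * c) + e / 2) * (x * b))%R.
  by rewrite ler_wpM2r// ltW.
have i5 : (k2 * ((c + e1) * (k1 * ((c + e1) * (x * b)))) =
   k * ((c + e1) * (c + e1)) * (x * b))%R by rewrite kE; ring.
lra.
Unshelve. all: by end_near. Qed.

(** The ratio bound limits q_d * M q_s to about |q_d| M q_s, and the part of q_d below A already
    accounts for almost all of it; so [high A (q d)] convolved with M q_s is small. As q_s <= q_d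
    for s <= d, this controls [high A (q s)] as well. *)
Lemma upper_ratio_negligible s d : (0 < s)%R -> (s <= d)%R ->
  uniformly_long_tailed (q s) -> upper_ratio s d -> negligible_middle (q s).
Proof.
move=> s0 sd su P e e0.
have d0 : (0 < d)%R by lra. have sd0 : (0 < s + d)%R by lra.
have hs := hq (ltW s0); have hd := hq (ltW d0); have hsd := hq (ltW sd0).
have hx := half_line_xmul hs.
have xu := uniformly_long_tailed_xmul su.
set md := (expR (lam * d) - 1)%R.
have md0 : (0 <= md)%R by rewrite subr_ge0 -expR0 ler_expR mulr_ge0 ?ltW.
pose k1 := (s / (s + d))%R.
have k10 : (0 < k1)%R by rewrite divr_gt0.
pose a := (Num.min 1 (e / (2 * (k1 + md + 2))))%R.
have z0 : (0 < 2 * (k1 + md + 2))%R by rewrite mulr_gt0//; lra.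
have a0 : (0 < a)%R by rewrite lt_min ltr01 divr_gt0.
have a1 : (a <= 1)%R by rewrite ge_min lexx.
have ae : (a * (2 * (k1 + md + 2)) <= e)%R by rewrite -ler_pdivlMr// ge_min lexx orbT.
move: a => a in a0 a1 ae *.
near (pinfty_nbhs R) => A.
have lA : (md - a)%:E <= \int[mu]_x low A (q d) x.
  by near: A; apply: integral_low_ge => //; exact: (int_q (ltW d0)).
have [l lE /andP[l0 lm]] := integral_low hd (int_q (ltW d0)) A.
rewrite lE lee_fin in lA.
have hls := half_line_high A hs; have hxls := half_line_xmul hls.
have hld := half_line_high A hd; have hlow := half_line_low A hd.
exists A; near=> x.
have x0 : (0 < x)%R by near: x; exact: near_pinfty_gt.
have /fin_pos[b b0 bE] : 0 < q s x < +oo by near: x; exact: su.1.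
have xqE : xmul (q s) x = (x * b)%:E by rewrite xmulE ?(ltW x0)// bE.
have h1 : ((1 - a) * l)%:E * xmul (q s) x <= convolution (xmul (q s)) (low A (q d)) x.
  have /andP[]// : ((1 - a) * l)%:E * xmul (q s) x <=
    convolution (xmul (q s)) (low A (q d)) x <= ((1 + a) * l)%:E * xmul (q s) x.
  by near: x; apply: conv_low => //; [exact: hx.1|rewrite a0].
have h2 : q (s + d)%R x <= ((s + d) / s * expR (lam * d) + a)%:E * q s x.
  by near: x; exact: (P a a0).
have h3 : xmul (q s) x + convolution (q d) (xmul (q s)) x <=
    ((expR (lam * d) + k1 * a) * (x * b))%:E.
  have -> : xmul (q s) x + convolution (q d) (xmul (q s)) x = k1%:E * xmul (q (s + d)%R) x.
    rewrite (xmul_cpoisD lam_gt0 hphi s0 (ltW d0)) muleA -EFinM.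
    by rewrite (_ : k1 * ((s + d) / s) = 1)%R ?mul1e// /k1; field; rewrite !gt_eqF.
  rewrite xmulE ?(ltW x0)//.
  apply: (@le_trans _ _ (k1%:E * (x%:E * (((s + d) / s * expR (lam * d) + a)%:E * q s x)))).
    by rewrite !lee_wpmul2l ?lee_fin ?(ltW x0) ?(ltW k10).
  rewrite bE -!EFinM lee_fin le_eqVlt; apply/orP; left; apply/eqP.
  by rewrite /k1; field; rewrite !gt_eqF.
have dE : convolution (q d) (xmul (q s)) x =
    convolution (low A (q d)) (xmul (q s)) x + convolution (high A (q d)) (xmul (q s)) x.
  have gE : q d = (fun y => low A (q d) y + high A (q d) y).
    by apply/funext => y; exact: low_high.
  by have := convDl hlow.1 hld.1 hx.1; rewrite -gE => ->.
(* Total minus low part: at most k1 a + md - (1 - a)(md - a) <= a (k1 + md + 1) times M q_s. *)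
have h4 : convolution (high A (q d)) (xmul (q s)) x <= ((e / 2) * (x * b))%:E.
  rewrite convC in h1; [|exact: hx.1|exact: hlow.1].
  move: h3; rewrite dE.
  have := (half_line_conv hlow hx).1.1 x; have := (half_line_conv hld hx).1.1 x.
  move: h1; rewrite xqE.
  case: (convolution (low A (q d)) _ x) => [y||]//;
    case: (convolution (high A (q d)) _ x) => [z||]//.
  rewrite -EFinM -!EFinD !lee_fin => y1 _ _ yz.
  have xb : (0 < x * b)%R by rewrite mulr_gt0.
  have : ((1 - a) * (md - a) * (x * b) <= (1 - a) * l * (x * b))%R.
    by rewrite ler_wpM2r ?(ltW xb)// ler_wpM2l// subr_ge0.
  have : (0 <= a * a * (x * b))%R by rewrite !mulr_ge0 ?ltW.
  have : (a * (2 * (k1 + md + 2)) * (x * b) <= e * (x * b))%R.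
    by rewrite ler_wpM2r// ltW.
  have : (0 <= a * (x * b))%R by rewrite mulr_ge0 ?ltW.
  have mdE : (expR (lam * d) = 1 + md)%R by rewrite /md; ring.
  rewrite mdE in yz; clear -yz y1 xb b0 x0 a0 a1 e0 k10 l0 lA; lra.
have h5 : xmul (convolution (high A (q s)) (high A (q s))) x <= (e * (x * b))%:E.
  rewrite xmul_conv// (convC hxls.1 hls.1).
  have le1 : convolution (high A (q s)) (xmul (high A (q s))) x <=
      convolution (high A (q d)) (xmul (q s)) x.
    apply: le_conv => // [||||y|y].
    - exact: hls.1.
    - exact: hxls.1.
    - exact: hld.1.
    - exact: hx.1.
    - by rewrite /high; case: ifP => // _; apply: le_cpois => //; exact: ltW.
    - by rewrite lee_wpmul2l ?maxr0_ge0// high_le.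
  have le2 := le_trans le1 h4.
  by apply: (le_trans (leeD le2 le2)); rewrite -EFinD lee_fin; lra.
rewrite xmulE ?(ltW x0)// in h5.
rewrite -(@lee_pmul2l _ x%:E) ?lte_fin// bE -!EFinM.
by rewrite mulrCA.
Unshelve. all: by end_near. Qed.

(** Only the upper half of the limit is carried through the doubling, until 2^n d >= s. *)
Lemma subexp_cpois_of_sim s d K : (0 < s)%R -> (0 < d)%R ->
  uniformly_long_tailed (q s) -> (0 < K)%R -> sim K (q (s + d)%R) (q s) ->
  subexp (q s).
Proof.
move=> s0 d0 su K0 sK; split=> //.
have P : upper_ratio s d.
  move=> e e0; have := sK e e0; apply: filterS => x /andP[_ h].
  apply: (le_trans h); rewrite lee_wpmul2r//; first exact: (hq (ltW s0)).1.1.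
  by rewrite lee_fin lerD2r; exact: sim_cpois_le.
have Pn n : upper_ratio s (2 ^+ n * d)%R.
  elim: n => [|n ih]; first by rewrite expr0 mul1r.
  have -> : (2 ^+ n.+1 * d = 2 ^+ n * d + 2 ^+ n * d)%R by rewrite exprS; ring.
  by apply: upper_ratio_double => //; rewrite mulr_gt0// exprn_gt0.
have [n sn] : exists n : nat, (s <= 2 ^+ n * d)%R.
  exists (Num.truncn (s / d)%R).+1; rewrite -ler_pdivrMr//.
  rewrite (le_trans (ltW (truncnS_gt _)))//.
  by rewrite -natrX ler_nat ltnW// ltn_expl.
exact: (upper_ratio_negligible s0 sn su (Pn n)).
Qed.

(** The smaller of t and 1 serves as base time. Once q_1 is subexponential, the direct part supplies
    a second limit of q_t / q_1, and uniqueness of limits gives C = t. *)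
Lemma cpoisson_density_converse t C : (0 < t)%R -> t <> 1%R -> (0 < C)%R ->
  long_tailed_density (cpoisson_density lam phi 1%R) ->
  asymp_equiv
    (fun x => (1 - expR (- (lam * t)))%:E * cpoisson_density lam phi t x)
    (fun x => (C * (1 - expR (- lam)))%:E * cpoisson_density lam phi 1%R x) ->
  C = t /\ subexp_density (cpoisson_density lam phi 1%R).
Proof.
move=> t0 t1 C0 [_ /uniform_of_long_tailed pu].
have h1 := hq (@ler01 R); have ht := hq (ltW t0).
have m0 : (0 < (expR (lam * 1) - 1)^-1)%R.
  by rewrite invr_gt0 subr_gt0 expR_gt1 mulr1.
have su : uniformly_long_tailed (q 1%R).
  apply: (uniformly_long_tailed_sim (c := ((expR (lam * 1) - 1)^-1)^-1%R)) pu _.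
    by rewrite invr_gt0.
  have E : q 1%R = fun x => ((expR (lam * 1) - 1)^-1)^-1%:E * cpoisson_density lam phi 1 x.
    apply/funext => x; rewrite (cpoisson_densityE lam_gt0 hphi ler01) muleA -EFinM.
    by rewrite mulVf ?mul1e// gt_eqF.
  rewrite [X in sim _ X _]E; apply: sim_scale => x.
  rewrite (cpoisson_densityE lam_gt0 hphi ler01).
  by rewrite mule_ge0 ?h1.1.1// lee_fin ltW.
rewrite (cpoisson_density_factor lam_gt0 hphi t0).
have -> : (fun x => (C * (1 - expR (- lam)))%:E * cpoisson_density lam phi 1 x) =
    (fun x => (C * expR (- lam))%:E * q 1%R x).
  have e := cpoisson_density_factor lam_gt0 hphi (@ltr01 R); rewrite mulr1 in e.
  apply/funext => x; rewrite !EFinM -!muleA.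
  by have := congr1 (fun f => f x) e => /= ->.
move=> /asymp_equiv_simP[||_ qpos S]; [exact: expR_gt0|by rewrite mulr_gt0 ?expR_gt0|].
set K := (C * expR (- lam) / expR (- (lam * t)))%R in S.
have K0 : (0 < K)%R by rewrite divr_gt0 ?mulr_gt0 ?expR_gt0.
have Q1 : subexp (q 1%R).
  have [t_lt1|t_gt1|//] := ltgtP t 1%R.
    (* For t < 1 long-tailedness passes from q_1 to q_t, the inverted limit shows q_t
       subexponential, and the direct part leads back to time 1. *)
    have tu := uniformly_long_tailed_sim K0 su S.
    have Qt : subexp (q t).
      apply: (@subexp_cpois_of_sim t (1 - t) K^-1%R) => //.
      - by rewrite subr_gt0.
      - by rewrite invr_gt0.
      - by rewrite subrKC; exact: simV.
    by have [] := subexp_cpois_all lam_gt0 hphi phi1 t0 ltr01 Qt.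
  apply: (@subexp_cpois_of_sim 1 (t - 1) K) => //; first by rewrite subr_gt0.
  by rewrite subrKC.
split; last exact/(subexp_density_cpois lam_gt0 hphi phi1 phi_fin phi_L2 ltr01).
have [_ S'] := subexp_cpois_all lam_gt0 hphi phi1 ltr01 t0 Q1.
have E := sim_uniq qpos S S'.
have nz := expR_gt0 (lam * (t - 1)).
apply: (mulIf (lt0r_neq0 nz)); rewrite -E /K.
rewrite -mulrA -expRN opprK -expRD; congr (_ * expR _)%R; ring.
Qed.

End compound_poisson_converse.

Theorem corollary1p1 (R : realType) (lam : R) (phi : R -> \bar R)
  (lam_gt0 : (0 < lam)%R)
  (phi_density : is_density phi)
  (phi_supp : forall x : R, (x < 0)%R -> phi x = 0)
  (phi_L2 : \int[@lebesgue_measure R]_(x in [set x : R | (0 <= x)%R])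
              (phi x) ^+ 2 < +oo) :
  let p := cpoisson_density lam phi in
  ((exists t : R, (0 < t)%R /\ subexp_density (p t)) ->
    forall t : R, (0 < t)%R ->
      subexp_density (p t) /\
      asymp_equiv (fun x => (1 - expR (- (lam * t)))%:E * p t x)
                  (fun x => (t * (1 - expR (- lam)))%:E * p 1%R x))
  /\
  (long_tailed_density (p 1%R) ->
    forall t C : R, (0 < t)%R -> t <> 1%R -> (0 < C)%R ->
      asymp_equiv (fun x => (1 - expR (- (lam * t)))%:E * p t x)
                  (fun x => (C * (1 - expR (- lam)))%:E * p 1%R x) ->
      C = t /\ subexp_density (p 1%R)).
Proof.
have [[phi_nn phi_meas] phi1] := phi_density.
have phi_ge0 x : 0 <= phi x by have /andP[] := phi_nn x.
have phi_fin x : phi x < +oo by have /andP[] := phi_nn x.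
have hphi : half_line phi by [].
split=> [[s [s0 ps]] t t0|p1 t C t0 t1 C0 ptC].
  exact: (subexp_cpoisson_density_all lam_gt0 hphi phi1 phi_fin phi_L2 s0).
exact: (cpoisson_density_converse lam_gt0 hphi phi1 phi_fin phi_L2 t0 t1 C0).
Qed.
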